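(* Let $d\in\{2,3\}$, $\mathbf{J}_p\in\mathbb{R}^d$, $\chi\ge0$, and let $U:\mathbb{R}^d\to(-\infty,\infty]$ be proper, closed, $\sigma$-strongly convex with $\sigma>0$, and two times continuously differentiable on its domain. For $\mathbf{H}\in\mathbb{R}^d$ let $\mathbf{J}=\mathbf{J}(\mathbf{H})$ denote the minimizer over $\mathbf{J}\in\mathbb{R}^d$ of $U(\mathbf{J})-\langle\mathbf{H},\mathbf{J}\rangle+\chi|\mathbf{J}-\mathbf{J}_p|$. Then the material law $\mathbf{B}(\mathbf{H})=\nabla_{\mathbf{H}}w^*(\mathbf{H})$ is semi-smooth and the matrix $$\mathbb{S}_{\mathbf{B}}=\begin{cases}\mu_0 I,&\text{if }\mathbf{J}=\mathbf{J}_p,\\[1mm] \mu_0I+\Big(\nabla^2_{\mathbf{J}\mathbf{J}}U(\mathbf{J})+\frac{\chi}{|\mathbf{J}-\mathbf{J}_p|}\Big(I-\frac{(\mathbf{J}-\mathbf{J}_p)\otimes(\mathbf{J}-\mathbf{J}_p)}{|\mathbf{J}-\mathbf{J}_p|^2}\Big)\Big)^{-1},&\text{if }\mathbf{J}\ne\mathbf{J}_p,\end{cases}$$ defines an element in the generalized Jacobian $\partial_{\mathbf{H}}\mathbf{B}(\mathbf{H})$, suitable for computations.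
   Context: $\mu_0>0$ is the permeability of vacuum, $I$ the $d\times d$ identity matrix, $a\otimes b=ab^\top$, and $$w^*(\mathbf{H})=\frac{\mu_0}{2}|\mathbf{H}|^2-\inf_{\mathbf{J}\in\mathbb{R}^d}\{U(\mathbf{J})-\langle\mathbf{H},\mathbf{J}\rangle+\chi|\mathbf{J}-\mathbf{J}_p|\}$$ is the co-energy density, which is continuously differentiable with $\nabla_{\mathbf{H}}w^*(\mathbf{H})=\mu_0\mathbf{H}+\mathbf{J}(\mathbf{H})$. A function $f:\mathbb{R}^d\to(-\infty,\infty]$ is closed if its epigraph is closed; its domain is $\{f<\infty\}$; it is proper if its domain is nonempty; it is $\sigma$-strongly convex if $f-\frac{\sigma}{2}|\cdot|^2$ is convex. For a locally Lipschitz $F:W\subset\mathbb{R}^n\to\mathbb{R}^m$ let $D_F$ be the set of points where $F$ is differentiable. The Bouligand subdifferential is $\partial^BF(x)=\{M\in\mathbb{R}^{m\times n}:\exists (x_k)\subset D_F,\ x_k\to x,\ \nabla F(x_k)\to M\}$ (with $\nabla F$ the Jacobian matrix), and Clarke's generalized Jacobian $\partial F(x)$ is the convex hull of $\partial^BF(x)$. $F$ is semi-smooth at $x$ if it is locally Lipschitz continuous, directionally differentiable, and $$\sup_{L\in\partial F(x+\delta x)}|F(x+\delta x)-F(x)-L\,\delta x|=o(|\delta x|)\quad\text{for }\delta x\to0;$$ it is semi-smooth if this holds at every point $x\in W$.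
   Formalization: The domain of U is taken to be open, and membership of S_B in the generalized Jacobian is claimed except when χ=0 and J(H)=J_p, where it is false (U=|J|²/2, J_p=0, H=0 gives ∂B={(μ0+1)I}, not μ0 I). *)

(* Defs.v *)
From mathcomp Require Import all_boot all_order all_algebra.
From mathcomp Require Import all_classical all_reals all_analysis.

Set Implicit Arguments.
Unset Strict Implicit.
Unset Printing Implicit Defensive.

Import Order.TTheory GRing.Theory Num.Theory.
Import numFieldNormedType.Exports.

Local Open Scope classical_set_scope.
Local Open Scope ring_scope.

(* Vectors of R^n are columns, so that a matrix L acts on h by L *m h and
   a (x) b = a *m b^T. *)
Section Euclidean.
Context {R : realType} {n : nat}.
Implicit Types a b : 'cV[R]_n.

Definition dotp a b : R := \sum_i a i 0 * b i 0.

(* The library norm `|a| of a matrix is the sup norm; it has the same topology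
   and the same differentials, but is not the |.| of the model. *)
Definition enorm a : R := Num.sqrt (dotp a a).

End Euclidean.

Section Differentials.
Context {R : realType}.

(* m x n Jacobian for the column convention: D F x h = jacobian_mx F x *m h
   (the library's [jacobian] is its transpose, for maps between row vectors). *)
Definition jacobian_mx n m (F : 'cV[R]_n -> 'cV[R]_m) (x : 'cV[R]_n) :
    'M[R]_(m, n) :=
  \matrix_(i, j) ('d F x (delta_mx j 0) : 'cV[R]_m) i 0.

Definition gradient n (f : 'cV[R]_n -> R) (x : 'cV[R]_n) : 'cV[R]_n :=
  \col_i ('d f x (delta_mx i 0) : R).

Definition hessian n (f : 'cV[R]_n -> R) (x : 'cV[R]_n) : 'M[R]_n :=
  jacobian_mx (gradient f) x.

End Differentials.

Section ExtendedConvex.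
Context {R : realType} {n : nat}.
Implicit Types (f : 'cV[R]_n -> \bar R) (sigma : R).

Definition edom f : set 'cV[R]_n := [set x | (f x < +oo)%E].

Definition epigraph f : set ('cV[R]_n * R) := [set p | (f p.1 <= p.2%:E)%E].

Definition closed_fun f : Prop := closed (epigraph f).

(* The library's [convex_function] is for real-valued functions. No ambiguous
   form +oo - oo arises: it is only applied to functions avoiding -oo, and
   0 * +oo = 0 in \bar R. *)
Definition econvex f : Prop :=
  forall (x y : 'cV[R]_n) (t : R), 0 <= t <= 1 ->
    (f (t *: x + (1 - t) *: y)%R <= t%:E * f x + (1 - t)%:E * f y)%E.

Definition strongly_convex sigma f : Prop :=
  econvex (fun x => f x - (sigma / 2 * enorm x ^+ 2)%:E)%E.

(* C^2 on the domain, in the usual sense of C^2 on an open set; f coincides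
   near every point of the open set [edom f] with the real function
   [fine \o f]. *)
Definition C2_on_domain f : Prop :=
  open (edom f) /\
  forall x, edom f x ->
    [/\ differentiable (fine \o f) x,
        differentiable (gradient (fine \o f)) x &
        {for x, continuous (hessian (fine \o f))}].

End ExtendedConvex.

Section Semismooth.
Context {R : realType} {n m : nat}.
Implicit Types (F : 'cV[R]_n -> 'cV[R]_m) (x : 'cV[R]_n).

Definition bouligand F x : set 'M[R]_(m, n) :=
  [set M | exists u : nat -> 'cV[R]_n,
     [/\ forall k, differentiable F (u k),
         u @ \oo --> x &
         (fun k => jacobian_mx F (u k)) @ \oo --> M]].

(* convex hull = smallest convex superset *)
Definition clarke F x : set 'M[R]_(m, n) :=
  smallest (@convex_set R 'M[R]_(m, n)) (bouligand F x).

(* Lipschitz continuity does not depend on the choice of equivalent norms. *)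
Definition lipschitz_near F x : Prop :=
  exists2 V, nbhs x V & [lipschitz F z | z in V].

Definition directionally_differentiable F x : Prop :=
  forall v : 'cV[R]_n,
    cvg ((fun t : R => t^-1 *: (F (x + t *: v) - F x)) @ 0^'+).

Definition semismooth_at F x : Prop :=
  [/\ lipschitz_near F x,
      directionally_differentiable F x &
      forall e : R, 0 < e -> \forall h \near (0 : 'cV[R]_n),
        (ereal_sup [set (enorm (F (x + h) - F x - L *m h))%:E
                   | L in clarke F (x + h)]
          <= (e * enorm h)%:E)%E].

Definition semismooth F : Prop := forall x, semismooth_at F x.

End Semismooth.

Section MaterialLaw.
Context {R : realType} {d : nat}.
Variables (mu0 chi : R) (Jp : 'cV[R]_d) (U : 'cV[R]_d -> \bar R).
Implicit Types H J : 'cV[R]_d.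

Definition objective H J : \bar R :=
  (U J - (dotp H J)%:E + (chi * enorm (J - Jp))%:E)%E.

(* the minimizer, or the arbitrary value 0 if there is none *)
Definition polarization H : 'cV[R]_d :=
  xget 0 [set J | forall K, (objective H J <= objective H K)%E].

(* [fine] is harmless: the infimum is finite for proper, closed and strongly
   convex U. *)
Definition coenergy H : R :=
  mu0 / 2 * enorm H ^+ 2 - fine (ereal_inf (range (objective H))).

Definition induction H : 'cV[R]_d := gradient coenergy H.

Definition induction_slope H : 'M[R]_d :=
  let J := polarization H in
  if J == Jp then mu0%:M
  else mu0%:M + invmx (hessian (fine \o U) J
         + (chi / enorm (J - Jp)) *:
           (1%:M - (enorm (J - Jp) ^- 2) *: ((J - Jp) *m (J - Jp)^T))).

End MaterialLaw.

(* Main.v *)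
From HB Require Import structures.
Require Import Defs.
From mathcomp Require Import all_boot all_order all_algebra.
From mathcomp Require Import all_classical all_reals all_analysis.
From mathcomp Require Import ring lra.

(* No implicit function theorem is needed.  Strong convexity makes the minimizer
   J(H) unique and 1/sigma-Lipschitz in H, and B(H) = mu0 H + J(H).  Optimality
   reads grad U(J) + chi (J - Jp)/|J - Jp| = H if J <> Jp, while J = Jp exactly
   when H lies in the closed ball of radius chi around grad U(Jp).  Let A(H) be
   the matrix inverted in the slope; A(H) >= sigma I.

   Outside the ball, expanding the optimality condition at J(H) or at a nearby
   J(H') and applying A^-1 shows that J has Jacobian A^-1 and is semismooth.
   In the ball J is constant.  If H0 is on the sphere and y is outside, then
   A(y) (J(y) - Jp) = (y - H0) + o(|y - H0|) - chi (n - n0) with unit vectors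
   n, n0.  The normal part of n - n0 is quadratic; the tangential part is damped
   by the large factor chi/|J(y) - Jp| of A(y), so that its preimage under A(y)
   is O(|J(y) - Jp|^(1/2) |n - n0|) = o(|y - H0|).

   Since B is Lipschitz, the semismoothness estimate only has to be checked at
   the points where B is differentiable: it passes to limits of Jacobians and
   to convex combinations. *)

Set Implicit Arguments.
Unset Strict Implicit.
Unset Printing Implicit Defensive.

Import Order.TTheory GRing.Theory Num.Theory.
Import numFieldNormedType.Exports.

Local Open Scope classical_set_scope.
Local Open Scope ring_scope.

(** * Estimates with an arbitrarily small parameter *)

Lemma ler_addsmall {R : realType} (a b k : R) :
  (forall e, 0 < e -> e <= 1 -> a <= b + e * k) -> a <= b.
Proof.
move=> h; apply/ler_addgt0Pr => e e0.
pose d := Num.min 1 (e / (`|k| + 1)).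
have k1 : 0 < `|k| + 1 by rewrite ltr_wpDl.
have d0 : 0 < d by rewrite lt_min ltr01 divr_gt0.
have d1 : d <= 1 by rewrite ge_min lexx.
apply: (le_trans (h d d0 d1)); rewrite lerD2l.
apply: (@le_trans _ _ (e / (`|k| + 1) * (`|k| + 1)));
  last by rewrite divfK ?gt_eqF.
apply: (@le_trans _ _ (d * (`|k| + 1))).
  by rewrite ler_wpM2l ?(ltW d0)// (le_trans (ler_norm _))// lerDl.
by rewrite ler_wpM2r ?(ltW k1)// ge_min lexx orbT.
Qed.

(** Lets an epsilon estimate be proved up to a constant factor [c], and only for e <= 1, so that
    powers of e can be compared. *)
Lemma eps_rescale {R : realType} (c : R) (Q : R -> Prop) :
  (forall a b, a <= b -> Q a -> Q b) ->
  (forall e, 0 < e -> e <= 1 -> Q (c * e)) -> forall e, 0 < e -> Q e.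
Proof.
move=> mQ hQ e e0; have k1 : 0 < `|c| + 1 by rewrite ltr_wpDl.
pose d := Num.min 1 (e / (`|c| + 1)).
have d0 : 0 < d by rewrite lt_min ltr01 divr_gt0.
apply: (mQ (c * d)); last by apply: hQ => //; rewrite ge_min lexx.
apply: (@le_trans _ _ ((`|c| + 1) * d)).
  by rewrite ler_wpM2r ?(ltW d0)// (le_trans (ler_norm _))// lerDl.
by rewrite -ler_pdivlMl// mulrC ge_min lexx orbT.
Qed.

(** * Euclidean norm *)

Section DotProduct.
Context {R : realType} {n : nat}.
Implicit Types (a b c : 'cV[R]_n) (k : R).

Lemma dotpC a b : dotp a b = dotp b a.
Proof. by apply: eq_bigr => i _; rewrite mulrC. Qed.

Lemma dotpDl a b c : dotp (a + b) c = dotp a c + dotp b c.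
Proof. by rewrite -big_split; apply: eq_bigr => i _; rewrite mxE mulrDl. Qed.

Lemma dotpZl k a b : dotp (k *: a) b = k * dotp a b.
Proof. by rewrite mulr_sumr; apply: eq_bigr => i _; rewrite mxE mulrA. Qed.

Lemma dotpNl a b : dotp (- a) b = - dotp a b.
Proof. by rewrite -scaleN1r dotpZl mulN1r. Qed.

Lemma dotpDr a b c : dotp c (a + b) = dotp c a + dotp c b.
Proof. by rewrite dotpC dotpDl !(dotpC c). Qed.

Lemma dotpZr k a b : dotp a (k *: b) = k * dotp a b.
Proof. by rewrite dotpC dotpZl dotpC. Qed.

Lemma dotpNr a b : dotp a (- b) = - dotp a b.
Proof. by rewrite dotpC dotpNl dotpC. Qed.

Definition dotpE := (dotpDl, dotpDr, dotpNl, dotpNr, dotpZl, dotpZr).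

Lemma dotp0l a : dotp 0 a = 0.
Proof. by rewrite -(scale0r (0 : 'cV_n)) dotpZl mul0r. Qed.

Lemma dotp_ge0 a : 0 <= dotp a a.
Proof. by apply: sumr_ge0 => i _; rewrite -expr2 sqr_ge0. Qed.

Lemma dotp_delta a i : dotp a (delta_mx i 0) = a i 0.
Proof.
rewrite /dotp (bigD1 i)//= mxE !eqxx mulr1 big1 ?addr0// => j ji.
by rewrite mxE (negbTE ji) mulr0.
Qed.

Lemma mx11_dotp a b : a^T *m b = (dotp a b)%:M.
Proof.
apply/matrixP => i j; rewrite !ord1 !mxE eqxx mulr1n.
by apply: eq_bigr => k _; rewrite mxE.
Qed.

Lemma enorm_ge0 a : 0 <= enorm a.
Proof. exact: sqrtr_ge0. Qed.

Lemma sqr_enorm a : enorm a ^+ 2 = dotp a a.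
Proof. by rewrite sqr_sqrtr// dotp_ge0. Qed.

Lemma enorm0 : enorm (0 : 'cV[R]_n) = 0.
Proof. by rewrite /enorm dotp0l sqrtr0. Qed.

Lemma enormZ k a : enorm (k *: a) = `|k| * enorm a.
Proof.
by rewrite /enorm !dotpE mulrA -expr2 sqrtrM ?sqr_ge0// sqrtr_sqr.
Qed.

Lemma enormN a : enorm (- a) = enorm a.
Proof. by rewrite -scaleN1r enormZ normrN1 mul1r. Qed.

Lemma enormBC a b : enorm (a - b) = enorm (b - a).
Proof. by rewrite -enormN opprB. Qed.

(** The vector <b,b> a - <a,b> b has squared norm <b,b> (<a,a> <b,b> - <a,b>^2), which is
    nonnegative; the case <b,b> = 0 is treated apart. *)
Lemma cauchy_schwarz a b : `|dotp a b| <= enorm a * enorm b.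
Proof.
rewrite /enorm -sqrtrM ?dotp_ge0// -sqrtr_sqr ler_sqrt ?mulr_ge0 ?dotp_ge0//.
have := dotp_ge0 (dotp b b *: a - dotp a b *: b); rewrite !dotpE (dotpC b a).
have := dotp_ge0 b; rewrite le0r => /orP[/eqP b0 _|b0 h]; last first.
  by rewrite -(ler_pM2l b0) -subr_ge0; apply: le_trans h _; rewrite le_eqVlt;
    apply/orP; left; apply/eqP; ring.
suff -> : dotp a b = 0 by rewrite expr0n mulr_ge0 ?dotp_ge0.
rewrite /dotp big1// => i _; suff -> : b i 0 = 0 by rewrite mulr0.
apply/eqP; rewrite -sqrf_eq0; move/eqP: b0.
by rewrite psumr_eq0 => [/allP/(_ i)|j _]; rewrite -?expr2 ?sqr_ge0//;
  rewrite mem_index_enum => /(_ isT).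
Qed.

Lemma dotp_le a b : dotp a b <= enorm a * enorm b.
Proof. exact: le_trans (ler_norm _) (cauchy_schwarz _ _). Qed.

Lemma enormD a b : enorm (a + b) <= enorm a + enorm b.
Proof.
rewrite -ler_sqr ?nnegrE ?addr_ge0 ?enorm_ge0// sqrrD !sqr_enorm !dotpE.
by have := dotp_le a b; rewrite (dotpC b a); lra.
Qed.

Lemma enormB a b : enorm (a - b) <= enorm a + enorm b.
Proof. by rewrite -(enormN b) enormD. Qed.

Lemma enorm_triangle c a b : enorm (a - b) <= enorm (a - c) + enorm (c - b).
Proof. by rewrite -{1}(subrK c a) -addrA enormD. Qed.

Lemma normr_enormB a b : `|enorm a - enorm b| <= enorm (a - b).
Proof.
have := enormD (a - b) b; have := enormD (b - a) a.
by rewrite !subrK (enormBC b a) ler_norml; lra.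
Qed.

Lemma ler_enorm a i : `|a i 0| <= enorm a.
Proof.
rewrite -sqrtr_sqr ler_sqrt ?dotp_ge0// /dotp (bigD1 i)//= expr2 lerDl.
by apply: sumr_ge0 => j _; rewrite -expr2 sqr_ge0.
Qed.

Lemma norm_le_enorm a : `|a| <= enorm a.
Proof.
rewrite [leLHS]/Num.Def.normr/= mx_normrE; apply: bigmax_le;
  first exact: enorm_ge0.
by move=> [i j] _ /=; rewrite (ord1 j); exact: ler_enorm.
Qed.

Lemma ler_mx_norm m (A : 'M[R]_(m, n)) i j : `|A i j| <= `|A|.
Proof.
rewrite [leRHS]/Num.Def.normr/= mx_normrE.
by apply: le_trans (le_bigmax _ _ (i, j)).
Qed.

Lemma enorm_le_norm a : enorm a <= n%:R * `|a|.
Proof.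
rewrite -[leRHS]ger0_norm ?mulr_ge0// -[leRHS]sqrtr_sqr ler_sqrt ?sqr_ge0//.
rewrite exprMn; apply: (@le_trans _ _ (n%:R * `|a| ^+ 2)); last first.
  by rewrite ler_wpM2r ?sqr_ge0// -natrX ler_nat; case: (n) => // m;
    rewrite leq_pmulr.
rewrite mulr_natl -[X in _ *+ X]card_ord -sumr_const; apply: ler_sum => i _.
by rewrite -expr2 -(real_normK (num_real (a i 0))) lerXn2r ?nnegrE//;
  rewrite [leRHS]/Num.Def.normr/= mx_normrE;
    apply: le_trans (le_bigmax _ _ (i, 0)).
Qed.

Lemma enorm_eq0 a : (enorm a == 0) = (a == 0).
Proof.
apply/eqP/eqP => [a0|->]; last exact: enorm0.
by apply/eqP; rewrite -normr_le0 -a0 norm_le_enorm.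
Qed.

Lemma enorm_gt0 a : (0 < enorm a) = (a != 0).
Proof. by rewrite lt0r enorm_ge0 andbT enorm_eq0. Qed.

Lemma eq_enorm_small a : (forall e, 0 < e -> enorm a <= e) -> a = 0.
Proof.
move=> h; apply/eqP; rewrite -enorm_eq0 eq_le enorm_ge0 andbT.
by apply/ler_addgt0Pr => e /h; rewrite add0r.
Qed.

End DotProduct.

(** * Operator bounds, Euclidean neighbourhoods and coercive matrices *)

Section Matrices.
Context {R : realType}.

Lemma enorm_mulmx_le n m (A : 'M[R]_(m, n)) (h : 'cV[R]_n) :
  enorm (A *m h) <= (m%:R * n%:R * `|A|) * enorm h.
Proof.
apply: (le_trans (enorm_le_norm _)); rewrite -!mulrA ler_wpM2l//.
rewrite [leLHS]/Num.Def.normr/= mx_normrE; apply: bigmax_le.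
  by rewrite !mulr_ge0 ?enorm_ge0.
move=> [i j] _ /=; rewrite mxE; apply: (le_trans (ler_norm_sum _ _ _)).
rewrite mulr_natl -[X in _ *+ X]card_ord -sumr_const; apply: ler_sum => k _.
by rewrite normrM ler_pM ?ler_mx_norm// (ord1 j) ler_enorm.
Qed.

Lemma ler_norm_trmx n m (A : 'M[R]_(m, n)) : `|A^T| <= `|A|.
Proof.
rewrite [leLHS]/Num.Def.normr/= mx_normrE.
by apply: bigmax_le => // -[i j] _ /=; rewrite mxE ler_mx_norm.
Qed.

Lemma near_enorm n (x : 'cV[R]_n) (P : 'cV[R]_n -> Prop) :
  (\forall y \near x, P y) <->
  exists2 r : R, 0 < r & forall y, enorm (y - x) < r -> P y.
Proof.
split=> [/nbhs_normP[r /= r0 h]|[r r0 h]].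
  exists r => // y yx; apply: h => /=.
  by rewrite -normrN opprB (le_lt_trans (norm_le_enorm _)).
(* The Euclidean norm is at most n times the sup norm; n + 1 keeps the divisor nonzero in dimension
   0. *)
apply/nbhs_normP; exists (r / n.+1%:R); first by rewrite /= divr_gt0.
move=> y /=; rewrite -normrN opprB ltr_pdivlMr// mulrC => yx; apply: h.
apply: le_lt_trans yx; apply: (le_trans (enorm_le_norm _)).
by rewrite ler_wpM2r// ler_nat.
Qed.

Section Coercive.
Context (n : nat) (A : 'M[R]_n) (s : R).
Hypothesis s_gt0 : 0 < s.
Hypothesis A_coercive : forall v, s * enorm v ^+ 2 <= dotp (A *m v) v.

(** A v = 0 forces s |v|^2 <= 0. The transposes appear because [kermx] consists of row vectors. *)
Lemma coercive_unitmx : A \in unitmx.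
Proof.
rewrite -unitmx_tr -row_free_unit -kermx_eq0.
apply/eqP/row_matrixP => i; rewrite row0; set u := row i _.
have uA : u *m A^T = 0 by apply: sub_kermxP; exact: row_sub.
have Au : A *m u^T = 0 by rewrite -(trmxK A) -trmx_mul uA trmx0.
have := A_coercive u^T; rewrite Au dotp0l pmulr_rle0// => u0.
have /eqP : enorm u^T == 0 by rewrite -sqrf_eq0 eq_le u0 sqr_ge0.
by move/eqP; rewrite enorm_eq0 => /eqP /(congr1 trmx); rewrite trmxK trmx0.
Qed.

(** Cauchy-Schwarz cancels one factor |v|. This bounds the norm of the inverse of [A] by 1/s without
    mentioning the inverse. *)
Lemma coercive_enorm_le v : s * enorm v <= enorm (A *m v).
Proof.
have := enorm_ge0 v; rewrite le0r => /orP[/eqP ->|v0].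
  by rewrite mulr0 enorm_ge0.
by rewrite -(ler_pM2r v0) -mulrA -expr2 (le_trans (A_coercive v)) ?dotp_le.
Qed.

End Coercive.

End Matrices.

(** * Differentiability in the Euclidean norm *)

Section EpsilonDelta.
Context {R : realType} {n : nat}.
Implicit Types x h : 'cV[R]_n.

Lemma diff_enormP (W : normedModType R) (f : 'cV[R]_n -> W) x :
  differentiable f x -> forall e : R, 0 < e -> exists2 r : R, 0 < r &
    forall h, enorm h < r -> `|f (x + h) - f x - 'd f x h| <= e * enorm h.
Proof.
move=> /diff_locally /eqaddoP df e e0.
have /near_enorm[r r0 hr] := df e e0; exists r => // h hlt.
have := hr h; rewrite subr0 => /(_ hlt) /=.
rewrite !fctE /= opprD addrA [h + x]addrC => /le_trans; apply.
by rewrite ler_wpM2l ?(ltW e0)// norm_le_enorm.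
Qed.

Lemma diff_enorm (W : normedModType R) (f : 'cV[R]_n -> W) x
    (df : {linear 'cV[R]_n -> W}) : continuous df ->
  (forall e : R, 0 < e -> exists2 r : R, 0 < r &
    forall h, enorm h < r -> `|f (x + h) - f x - df h| <= e * enorm h) ->
  differentiable f x /\ 'd f x = df :> (_ -> _).
Proof.
move=> cdf H.
have fo : f \o shift x = cst (f x) + df +o_ (0 : 'cV[R]_n) id.
  apply/eqaddoP => e e0.
  have en0 : 0 < e / n.+1%:R by rewrite divr_gt0.
  have [r r0 hr] := H _ en0.
  apply/near_enorm; exists r => // h; rewrite subr0 => /hr.
  rewrite !fctE /= opprD addrA [h + x]addrC => /le_trans; apply.
  rewrite mulrAC ler_pdivrMr// -mulrA ler_wpM2l ?(ltW e0)// mulrC.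
  by apply: (le_trans (enorm_le_norm _)); rewrite ler_wpM2r// ler_nat.
have dE := diff_unique cdf fo.
by split => //; apply/diff_locallyP; rewrite dE.
Qed.

Lemma linear_enorm_continuous (W : normedModType R)
    (df : {linear 'cV[R]_n -> W}) (c : R) :
  (forall h, `|df h| <= c * enorm h) -> continuous df.
Proof.
move=> hc a; apply/(@cvgrPdist_le _ _ _ (nbhs a)) => e e0.
pose k : R := `|c| + 1; have k0 : 0 < k by rewrite ltr_wpDl.
apply/near_enorm; exists (e / k); first by rewrite divr_gt0.
move=> y; rewrite ltr_pdivlMr// mulrC => /ltW; apply: le_trans.
rewrite -raddfB; apply: (le_trans (hc _)).
by rewrite enormBC ler_wpM2r ?enorm_ge0// (le_trans (ler_norm _))// lerDl.
Qed.

Lemma colE_sum_delta h : h = \sum_j h j 0 *: delta_mx j 0.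
Proof.
apply/colP => i; rewrite summxE (bigD1 i)//= !mxE !eqxx mulr1 big1 ?addr0//.
by move=> j ji; rewrite !mxE eq_sym (negbTE ji) mulr0.
Qed.

Lemma diffE_jacobian_mx m (F : 'cV[R]_n -> 'cV[R]_m) x h :
  'd F x h = jacobian_mx F x *m h.
Proof.
rewrite {1}(colE_sum_delta h) linear_sum; apply/colP => i.
rewrite summxE mxE; apply: eq_bigr => j _.
by rewrite linearZ !mxE mulrC.
Qed.

Lemma diffE_gradient (f : 'cV[R]_n -> R) x h :
  'd f x h = dotp (gradient f x) h.
Proof.
rewrite {1}(colE_sum_delta h) linear_sum; apply: eq_bigr => j _.
by rewrite linearZ !mxE/= mulrC.
Qed.

Lemma differentiable_enorm m (F : 'cV[R]_n -> 'cV[R]_m) x :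
  differentiable F x -> forall e : R, 0 < e -> exists2 r : R, 0 < r &
    forall y, enorm (y - x) < r ->
      enorm (F y - F x - jacobian_mx F x *m (y - x)) <= e * enorm (y - x).
Proof.
move=> dF e e0; have em0 : 0 < e / m.+1%:R by rewrite divr_gt0.
have [r r0 hr] := diff_enormP dF em0; exists r => // y /hr.
rewrite subrKC diffE_jacobian_mx => h; apply: le_trans (enorm_le_norm _) _.
apply: (@le_trans _ _ (m.+1%:R * `|F y - F x - jacobian_mx F x *m (y - x)|)).
  by rewrite ler_wpM2r// ler_nat.
apply: (@le_trans _ _ (m.+1%:R * (e / m.+1%:R * enorm (y - x)))).
  by rewrite ler_wpM2l.
by rewrite mulrA mulrCA mulfV ?mulr1// pnatr_eq0.
Qed.

Lemma enorm_differentiable m (F : 'cV[R]_n -> 'cV[R]_m) x (L : 'M[R]_(m, n)) :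
  (forall e : R, 0 < e -> exists2 r : R, 0 < r &
    forall y, enorm (y - x) < r ->
      enorm (F y - F x - L *m (y - x)) <= e * enorm (y - x)) ->
  differentiable F x /\ jacobian_mx F x = L.
Proof.
move=> H.
have cL : continuous (mulmx L : 'cV[R]_n -> 'cV[R]_m).
  apply: (@linear_enorm_continuous _ (mulmx L)) => h.
  exact: le_trans (norm_le_enorm _) (enorm_mulmx_le _ _).
have [|dF dE] := @diff_enorm _ F x (mulmx L) cL.
  move=> e /H[r r0 hr]; exists r => // h hlt;
    apply: le_trans (norm_le_enorm _) _.
  by have := hr (x + h); rewrite addrAC subrr add0r => /(_ hlt).
split=> //; apply/matrixP => i j; rewrite mxE dE.
rewrite mxE (bigD1 j)//= mxE !eqxx mulr1 big1 ?addr0// => k kj.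
by rewrite mxE (negbTE kj) mulr0.
Qed.

Lemma differentiable_gradient (f : 'cV[R]_n -> R) x :
  differentiable f x -> forall e : R, 0 < e -> exists2 r : R, 0 < r &
    forall y, enorm (y - x) < r ->
      `|f y - f x - dotp (gradient f x) (y - x)| <= e * enorm (y - x).
Proof.
move=> dF e e0; have [r r0 hr] := diff_enormP dF e0; exists r => // y /hr.
by rewrite subrKC diffE_gradient.
Qed.

Lemma enorm_gradient (f : 'cV[R]_n -> R) x (g : 'cV[R]_n) :
  (forall e : R, 0 < e -> exists2 r : R, 0 < r &
    forall y, enorm (y - x) < r ->
      `|f y - f x - dotp g (y - x)| <= e * enorm (y - x)) ->
  gradient f x = g.
Proof.
move=> H.
have lin : linear (dotp g : 'cV[R]_n -> R).
  by move=> k u v; rewrite !dotpE.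
(* [diff_enorm] takes a bundled linear map, so the pairing with g is packaged as one. *)
pose lg := GRing.isLinear.Build R 'cV[R]_n R _ _ lin.
pose dg : {linear 'cV[R]_n -> R} := HB.pack (dotp g : 'cV[R]_n -> R) lg.
have cg : continuous dg.
  by apply: (@linear_enorm_continuous _ dg) => h; exact: cauchy_schwarz.
have [|dF dE] := @diff_enorm _ f x dg cg.
  move=> e /H[r r0 hr]; exists r => // h hlt.
  by have := hr (x + h); rewrite addrAC subrr add0r => /(_ hlt).
by apply/colP => i; rewrite mxE dE /= dotp_delta.
Qed.

End EpsilonDelta.

(** * Semismoothness *)

Section GeneralizedJacobian.
Context {R : realType} {n m : nat}.
Implicit Types (F : 'cV[R]_n -> 'cV[R]_m) (x y : 'cV[R]_n).

Lemma clarke_sub_convex F x (P : set 'M[R]_(m, n)) :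
  (forall A B (t : R), 0 <= t <= 1 -> P A -> P B -> P (t *: A + (1 - t) *: B))
    ->
  bouligand F x `<=` P -> clarke F x `<=` P.
Proof.
move=> cP bP; apply: smallest_sub => // A B l /set_mem PA /set_mem PB.
by apply/mem_set; apply: cP => //; rewrite ge0 le1.
Qed.

(** The constant sequence at x already witnesses membership in the Bouligand subdifferential. *)
Lemma differentiable_clarke F x : differentiable F x ->
  clarke F x (jacobian_mx F x).
Proof.
by move=> dF; apply: sub_gen_smallest; exists (fun=> x); split => //;
  exact: cvg_cst.
Qed.

Definition has_directional F x v (l : 'cV[R]_m) : Prop :=
  forall e : R, 0 < e -> exists2 r : R, 0 < r & forall t, 0 < t -> t < r ->
    enorm (t^-1 *: (F (x + t *: v) - F x) - l) <= e.

Lemma has_directionalP F x : (forall v, exists l, has_directional F x v l) ->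
  directionally_differentiable F x.
Proof.
move=> H v; have [l hl] := H v; apply/cvg_ex; exists l.
apply/cvgrPdist_le => e /hl [r r0 hr].
have tr : \forall t \near (0 : R)^'+, t < r by exact: nbhs_right_lt.
have t0 : \forall t \near (0 : R)^'+, 0 < t by exact: nbhs_right_gt.
apply: filterS2 tr t0 => t tr t0; apply: le_trans (norm_le_enorm _) _.
by rewrite enormBC hr.
Qed.

Lemma differentiable_has_directional F x v : differentiable F x ->
  has_directional F x v (jacobian_mx F x *m v).
Proof.
move=> dF; apply: (@eps_rescale _ (enorm v)) => [a b ab [r r0 hr]|e e0 _].
  by exists r => // t t0 tr; apply: le_trans (hr t t0 tr) ab.
have [r r0 hr] := differentiable_enorm dF e0.
have v1 : 0 < enorm v + 1 by rewrite ltr_wpDl// enorm_ge0.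
exists (r / (enorm v + 1)) => [|t t0]; first by rewrite divr_gt0.
rewrite ltr_pdivlMr// => tr; have := hr (x + t *: v).
have -> : x + t *: v - x = t *: v by rewrite addrC addKr.
rewrite enormZ gtr0_norm// => h; rewrite -(ler_pM2l t0).
rewrite -{1}(gtr0_norm t0) -enormZ scalerBr scalerA mulfV ?gt_eqF// scale1r.
rewrite scalemxAr [leRHS](_ : _ = e * (t * enorm v)); last by ring.
by apply: h; apply: le_lt_trans tr; rewrite ler_wpM2l ?(ltW t0)// lerDl.
Qed.

(** The matrices L satisfying the estimate at x + h form a convex set, so limits of Jacobians
    suffice. For such a limit, the estimate at u_j -> x + h is transported to x + h by the Lipschitz
    bound and the convergence of the Jacobians. *)
Lemma semismooth_atP F x (c : R) :
  (forall y z, enorm (F y - F z) <= c * enorm (y - z)) ->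
  directionally_differentiable F x ->
  (forall e : R, 0 < e -> exists2 r : R, 0 < r &
    forall y, enorm (y - x) < r -> differentiable F y ->
      enorm (F y - F x - jacobian_mx F y *m (y - x)) <= e * enorm (y - x)) ->
  semismooth_at F x.
Proof.
move=> cF dirF H; split=> //.
  exists setT; first exact: filterT.
  apply: (@klipschitzW _ _ _ (`|c| * n%:R) F _
    (@globally_properfilter _ (setT `*` setT) (x, x) (conj I I))).
  rewrite /dominated_by /globally /= => -[y z] _ /=.
  apply: (le_trans (norm_le_enorm _)).
  apply: (le_trans (cF _ _)); rewrite -mulrA.
  apply: (@le_trans _ _ (`|c| * enorm (y - z))).
    by rewrite ler_wpM2r ?enorm_ge0 ?ler_norm.
  by rewrite ler_wpM2l ?enorm_le_norm.
move=> e e0; have [r r0 hr] := H e e0.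
apply/near_enorm; exists r => // h; rewrite subr0 => hlt.
apply: ge_ereal_sup => _ [L + <-]; rewrite lee_fin.
pose P := [set L | enorm (F (x + h) - F x - L *m h) <= e * enorm h].
suff /(_ L) : clarke F (x + h) `<=` P by [].
apply: clarke_sub_convex.
  move=> A B t /andP[t0 t1]; rewrite /P /= => PA PB.
  have -> : F (x + h) - F x - (t *: A + (1 - t) *: B) *m h =
      t *: (F (x + h) - F x - A *m h) + (1 - t) *: (F (x + h) - F x - B *m h).
    rewrite mulmxDl -!scalemxAl; apply/colP => i; rewrite !mxE; ring.
  apply: (le_trans (enormD _ _)); rewrite !enormZ !ger0_norm ?subr_ge0//.
  by nra.
move=> {}L [u [du cu cL]]; rewrite /P /=.
(* The four summands pay, in units of eta, for replacing |h| by |u_j - x|, F(x + h) by F(u_j), L by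
   the Jacobian at u_j, and h by u_j - x under L. *)
pose k := e + `|c| + m%:R * n%:R * (enorm h + 1) + m%:R * n%:R * `|L|.
apply: (@ler_addsmall _ _ _ k) => eta eta0 eta1.
(* The second bound keeps u_j in the ball of radius r around x. *)
pose s := Num.min eta (r - enorm h).
have s0 : 0 < s by rewrite lt_min eta0 subr_gt0.
have seta : s <= eta by rewrite ge_min lexx.
have sr : s <= r - enorm h by rewrite ge_min lexx orbT.
have cu' : \forall j \near \oo, enorm (u j - (x + h)) < s.
  have nb : \forall v \near x + h, enorm (v - (x + h)) < s.
    by apply/near_enorm; exists s.
  exact: (cu _ nb).
have cL' : \forall j \near \oo, `|L - jacobian_mx F (u j)| <= eta.
  by move/cvgrPdist_le : cL; apply.
have [j [uj Lj]] : exists j, enorm (u j - (x + h)) < s /\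
    `|L - jacobian_mx F (u j)| <= eta.
  by have [j [? ?]] := @filter_ex _ _ eventually_filter _ (filterI cu' cL');
    exists j.
set A := jacobian_mx F (u j) in Lj *.
have xh : x + h - x = h by rewrite addrC addKr.
have ux : enorm (u j - x) <= enorm h + s.
  have := enorm_triangle (x + h) (u j) x.
  by rewrite xh; lra.
have uxr : enorm (u j - x) < r.
  have := enorm_triangle (x + h) (u j) x.
  by rewrite xh; lra.
have := hr (u j) uxr (du j); rewrite -/A => est.
have -> : F (x + h) - F x - L *m h = (F (u j) - F x - A *m (u j - x))
   + (F (x + h) - F (u j)) - (L - A) *m (u j - x) + L *m (u j - (x + h)).
  rewrite mulmxBl !mulmxBr mulmxDr.
  by apply/colP => i; rewrite !mxE; ring.
apply: (le_trans (enormD _ _)).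
have e1 := enormB ((F (u j) - F x - A *m (u j - x))
   + (F (x + h) - F (u j))) ((L - A) *m (u j - x)).
have e2 := enormD (F (u j) - F x - A *m (u j - x)) (F (x + h) - F (u j)).
have e3 := cF (x + h) (u j); rewrite (enormBC (x + h)) in e3.
have e4 := enorm_mulmx_le (L - A) (u j - x).
have e5 := enorm_mulmx_le L (u j - (x + h)).
have mn0 : 0 <= m%:R * n%:R :> R by rewrite mulr_ge0.
have h0 := enorm_ge0 h; have u0 := enorm_ge0 (u j - (x + h)).
have e1' : e * enorm (u j - x) <= e * enorm h + e * eta.
  by rewrite -mulrDr ler_wpM2l ?(ltW e0)//; lra.
have e3' : c * enorm (u j - (x + h)) <= `|c| * eta.
  apply: (@le_trans _ _ (`|c| * enorm (u j - (x + h)))).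
    by rewrite ler_wpM2r ?ler_norm.
  by rewrite ler_wpM2l//; lra.
have e4' : m%:R * n%:R * `|L - A| * enorm (u j - x) <=
    m%:R * n%:R * eta * (enorm h + 1).
  by rewrite ler_pM ?mulr_ge0 ?enorm_ge0 ?ler_wpM2l//; lra.
have e5' : m%:R * n%:R * `|L| * enorm (u j - (x + h)) <=
    m%:R * n%:R * `|L| * eta.
  by rewrite ler_wpM2l ?mulr_ge0//; lra.
rewrite /k; lra.
Qed.

End GeneralizedJacobian.

(** Used with k = mu0 to pass from J to B, and with k = - mu0 to return. *)
Lemma scale_add_differentiable {R : realType} n (k : R)
  (F : 'cV[R]_n -> 'cV[R]_n) x :
  differentiable F x -> differentiable (fun y => k *: y + F y) x /\
    jacobian_mx (fun y => k *: y + F y) x = k%:M + jacobian_mx F x.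
Proof.
move=> dF; apply: enorm_differentiable => e /(differentiable_enorm dF)[r r0 hr].
exists r => // y /hr; congr (enorm _ <= _); rewrite mulmxDl mul_scalar_mx.
by move: (_ *m _) (F y) (F x) => *; apply/colP => i; rewrite !mxE; ring.
Qed.

(** * Strongly convex functions *)

Section StronglyConvex.
Context {R : realType} {d : nat} (U : 'cV[R]_d -> \bar R) (sigma : R).
Hypothesis U_gtNy : forall J, U J <> -oo%E.
Hypothesis sigma_gt0 : 0 < sigma.
Hypothesis U_convex : strongly_convex sigma U.

Local Notation u := (fine \o U : 'cV[R]_d -> R).

Lemma edom_fineE x : edom U x -> U x = (u x)%:E.
Proof.
rewrite /edom /= => Ux; rewrite fineK// fin_numE (lt_eqF Ux) andbT.
exact/eqP/U_gtNy.
Qed.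

(** Real-valued form of strong convexity; the quadratic term comes from t |y|^2 + (1 - t) |x|^2 - |t
    y + (1 - t) x|^2 = t (1 - t) |y - x|^2. *)
Lemma strongly_convex_segment x y (t : R) : 0 <= t <= 1 ->
  edom U x -> edom U y ->
  edom U (x + t *: (y - x)) /\
  u (x + t *: (y - x)) <=
    u x + t * (u y - u x) - sigma / 2 * (t * (1 - t)) * enorm (y - x) ^+ 2.
Proof.
move=> t01 Ux Uy; have := U_convex y x t01.
have -> : t *: y + (1 - t) *: x = x + t *: (y - x).
  by apply/colP => i; rewrite !mxE; ring.
rewrite (edom_fineE Ux) (edom_fineE Uy) -!EFinB -!EFinM -EFinD => h.
have Uz : edom U (x + t *: (y - x)).
  rewrite /edom /=; have := @U_gtNy (x + t *: (y - x)).
  by move: h; case: (U _) => // r _; rewrite ltry.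
split=> //; move: h; rewrite (edom_fineE Uz) -EFinB lee_fin.
rewrite !sqr_enorm !dotpE (dotpC y x); lra.
Qed.

(** The segment inequality is divided by t as t tends to 0. Here e is the differentiability error
    and s >= t the loss from replacing t (1 - t) by t. *)
Lemma gradient_ineq x y : edom U x -> differentiable u x -> edom U y ->
  u x + dotp (gradient u x) (y - x) + sigma / 2 * enorm (y - x) ^+ 2 <= u y.
Proof.
move=> Ux dU Uy; set g := gradient u x.
have [->|yx] := eqVneq y x.
  by rewrite subrr enorm0 dotpC dotp0l expr0n/= mulr0 !addr0.
have n0 : 0 < enorm (y - x) by rewrite enorm_gt0 subr_eq0.
pose N := enorm (y - x).
apply: (@ler_addsmall _ _ _ N) => e e0 e1.
have [r r0 hr] := differentiable_gradient dU e0.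
apply: (@ler_addsmall _ _ _ (sigma / 2 * N ^+ 2)) => s s0 s1.
pose t := Num.min s (r / (2 * N)).
have t0 : 0 < t by rewrite lt_min s0 divr_gt0// mulr_gt0.
have ts : t <= s by rewrite ge_min lexx.
have tr : t * N < r.
  apply: (@le_lt_trans _ _ (r / (2 * N) * N)).
    by rewrite ler_wpM2r ?(ltW n0)// ge_min lexx orbT.
  by rewrite invfM mulrA divfK ?gt_eqF// ltr_pdivrMr//; lra.
have t01 : 0 <= t <= 1 by rewrite (ltW t0) (le_trans ts).
have [_ hc] := strongly_convex_segment t01 Ux Uy.
have zx : x + t *: (y - x) - x = t *: (y - x) by rewrite addrC addKr.
have := hr (x + t *: (y - x)); rewrite zx enormZ gtr0_norm// => /(_ tr).
rewrite dotpZr ler_norml => /andP[h _]; rewrite -/N -/g in h hc *.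
have k : t * (t * (sigma / 2 * N ^+ 2)) <= t * (s * (sigma / 2 * N ^+ 2)).
  rewrite ler_wpM2l ?(ltW t0)// ler_wpM2r// mulr_ge0 ?sqr_ge0//.
  by rewrite divr_ge0// ltW.
rewrite -(ler_pM2l t0); lra.
Qed.

Lemma gradient_mono x y : edom U x -> differentiable u x ->
  edom U y -> differentiable u y ->
  sigma * enorm (y - x) ^+ 2 <= dotp (gradient u y - gradient u x) (y - x).
Proof.
move=> Ux dx Uy dy; have := gradient_ineq Ux dx Uy;
  have := gradient_ineq Uy dy Ux.
rewrite (enormBC x y); move: (gradient u x) (gradient u y) (u x) (u y).
move=> gx gy ux uy; rewrite !dotpE.
move: (dotp gx x) (dotp gx y) (dotp gy x) (dotp gy y) (enorm _ ^+ 2).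
by move=> *; lra.
Qed.

(** Monotonicity of the gradient between x and x + t v, divided by t^2. *)
Lemma hessian_ge x v : open (edom U) -> edom U x ->
  (forall y, edom U y -> differentiable u y) ->
  differentiable (gradient u) x ->
  sigma * enorm v ^+ 2 <= dotp (hessian u x *m v) v.
Proof.
move=> oU Ux du dg.
have /near_enorm[s s0 hs] : \forall y \near x, edom U y by exact:
  (open_nbhs_nbhs (conj oU Ux)).
apply: (@ler_addsmall _ _ _ (enorm v ^+ 2)) => e e0 e1.
have [r r0 hr] := differentiable_enorm dg e0.
pose N := enorm v + 1; have N0 : 0 < N by rewrite ltr_wpDl// enorm_ge0.
pose q := Num.min r s; have q0 : 0 < q by rewrite lt_min r0.
pose t := q / (2 * N); have t0 : 0 < t by rewrite divr_gt0// mulr_gt0.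
have tv : enorm (t *: v) < q.
  rewrite enormZ gtr0_norm//; apply: (@lt_trans _ _ (t * N)).
    by rewrite ltr_pM2l// ltrDl.
  by rewrite /t invfM mulrA divfK ?gt_eqF// ltr_pdivrMr//; lra.
have zx : x + t *: v - x = t *: v by rewrite addrC addKr.
have := hr (x + t *: v); have := hs (x + t *: v); rewrite zx.
move=> /(_ (lt_le_trans tv _)) Uz /(_ (lt_le_trans tv _)) h.
have {}Uz : edom U (x + t *: v) by apply: Uz; rewrite ge_min lexx orbT.
have {h} : enorm (gradient u (x + t *: v) - gradient u x -
    hessian u x *m (t *: v)) <= e * enorm (t *: v).
  by apply: h; rewrite ge_min lexx.
have := gradient_mono Ux (du _ Ux) Uz (du _ Uz); rewrite zx.
move: (gradient u (x + t *: v) - gradient u x) (hessian u x) => a A m h.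
have := dotp_le (a - A *m (t *: v)) (t *: v).
have := ler_wpM2r (enorm_ge0 (t *: v)) h.
move: m; rewrite -scalemxAr !dotpE enormZ (gtr0_norm t0).
move: (enorm (a - _)) (dotp a v) (dotp (A *m v) v) (enorm v) => N1 N2 N3 N4.
move=> h1 h2 h3; rewrite -(ler_pM2l (mulr_gt0 t0 t0)); lra.
Qed.

End StronglyConvex.

(** * The minimizer and the co-energy *)

Section Minimizer.
Context {R : realType} {d : nat} (U : 'cV[R]_d -> \bar R) (sigma chi : R).
Context (Jp : 'cV[R]_d).
Hypothesis U_gtNy : forall J, U J <> -oo%E.
Hypothesis U_proper : edom U !=set0.
Hypothesis U_closed : closed_fun U.
Hypothesis sigma_gt0 : 0 < sigma.
Hypothesis U_convex : strongly_convex sigma U.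
Hypothesis chi_ge0 : 0 <= chi.
Hypothesis U_diff : forall x, edom U x -> differentiable (fine \o U) x.

Local Notation u := (fine \o U : 'cV[R]_d -> R).

(* Meaningful only on [edom U]: elsewhere [fine] turns +oo into 0. *)
Definition energy (H K : 'cV[R]_d) : R := u K - dotp H K + chi * enorm (K - Jp).

Lemma objectiveE H K : edom U K -> objective chi Jp U H K = (energy H K)%:E.
Proof. by move=> UK; rewrite /objective (edom_fineE U_gtNy UK). Qed.

Lemma objective_ndom H K : ~ edom U K -> objective chi Jp U H K = +oo%E.
Proof.
rewrite /edom /objective /=; have := @U_gtNy K.
by case: (U K) => [r _|_|]// /(_ (ltry r)).
Qed.

(** The linear term and the convex term chi |K - Jp| preserve the modulus sigma. *)
Lemma energy_strongly_convex H J K (t : R) : 0 <= t <= 1 ->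
  edom U J -> edom U K ->
  energy H (J + t *: (K - J)) <= energy H J + t * (energy H K - energy H J)
    - sigma / 2 * (t * (1 - t)) * enorm (K - J) ^+ 2.
Proof.
move=> t01 UJ UK; have [_] := strongly_convex_segment U_gtNy U_convex t01 UJ UK.
have : enorm (J + t *: (K - J) - Jp) <=
    (1 - t) * enorm (J - Jp) + t * enorm (K - Jp).
  have -> : J + t *: (K - J) - Jp = (1 - t) *: (J - Jp) + t *: (K - Jp).
    by apply/colP => i; rewrite !mxE; ring.
  have /andP[t0 t1] := t01.
  by apply: le_trans (enormD _ _) _; rewrite !enormZ !ger0_norm ?subr_ge0.
move/(ler_wpM2l chi_ge0); rewrite /energy !dotpE.
move: (u _) (u J) (u K) (enorm (J - Jp)) (enorm (K - Jp)) (enorm _)  =>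
  a b c e f g.
by move: (dotp H J) (dotp H K) (enorm _ ^+ 2) => *; lra.
Qed.

(** Minimality is tested at J + t (K - J), divided by t, and t tends to 0. This quadratic growth
    yields both uniqueness and the Lipschitz bound of the minimizer. *)
Lemma energy_min_gap H J K : edom U J -> edom U K ->
  (forall K, edom U K -> energy H J <= energy H K) ->
  energy H J + sigma / 2 * enorm (K - J) ^+ 2 <= energy H K.
Proof.
move=> UJ UK minJ.
apply: (@ler_addsmall _ _ _ (sigma / 2 * enorm (K - J) ^+ 2)) => t t0 t1.
have t01 : 0 <= t <= 1 by rewrite ltW.
have [Ut _] := strongly_convex_segment U_gtNy U_convex t01 UJ UK.
have := minJ _ Ut; have := energy_strongly_convex H t01 UJ UK.
move: (energy _ _) (energy _ _) (energy _ _) (enorm _ ^+ 2) => a b c e h1 h2.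
by rewrite -(ler_pM2l t0); lra.
Qed.

Lemma minimizer_unique H J K : edom U J -> edom U K ->
  (forall K, edom U K -> energy H J <= energy H K) ->
  (forall J, edom U J -> energy H K <= energy H J) -> K = J.
Proof.
move=> UJ UK mJ mK; have := energy_min_gap UJ UK mJ; have := mK _ UJ.
move=> h1 h2; apply/eqP; rewrite -subr_eq0 -enorm_eq0 -sqrf_eq0 eq_le sqr_ge0
  andbT.
rewrite -(pmulr_rle0 _ (divr_gt0 sigma_gt0 (ltr0Sn _ 1))).
by move: (energy H J) (energy H K) (sigma / 2 * _) h1 h2 => *; lra.
Qed.

Lemma continuous_enormB (c : 'cV[R]_d) :
  continuous (fun x : 'cV[R]_d => enorm (x - c)).
Proof.
move=> x; apply/(@cvgrPdist_le _ _ _ (nbhs x)) => e e0.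
apply/near_enorm; exists e => // y /ltW yx; apply: le_trans yx.
apply: le_trans (normr_enormB _ _) _.
by rewrite opprB addrA subrK enormBC.
Qed.

Lemma continuous_dotp (c : 'cV[R]_d) : continuous (dotp c).
Proof.
move=> x; apply/(@cvgrPdist_le _ _ _ (nbhs x)) => e e0.
have k0 : 0 < enorm c + 1 by rewrite ltr_wpDl// enorm_ge0.
apply/near_enorm; exists (e / (enorm c + 1)); first by rewrite divr_gt0.
move=> y; rewrite ltr_pdivlMr// mulrC => /ltW; apply: le_trans.
rewrite -dotpNr -dotpDr; apply: (le_trans (cauchy_schwarz _ _)).
by rewrite enormBC ler_wpM2r ?enorm_ge0// lerDl.
Qed.

(** Bounded closed sets of row vectors are compact; continuous transposition carries this to
    columns. *)
Lemma compact_enorm_ball (c : 'cV[R]_d) (M : R) :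
  compact [set x : 'cV[R]_d | enorm (x - c) <= M].
Proof.
pose A := [set v : 'rV[R]_d | enorm (v^T - c) <= M].
have ctr : continuous (trmx : 'rV[R]_d -> 'cV[R]_d).
  move=> v; apply/(@cvgrPdist_le _ _ _ (nbhs v)) => e e0.
  apply/(@nbhs_normP _ _ v); exists e => // w /= vw; rewrite -linearB/=.
  exact: le_trans (ler_norm_trmx _) (ltW vw).
have cen := @continuous_enormB c.
have -> : [set x : 'cV[R]_d | enorm (x - c) <= M] = trmx @` A.
  apply/seteqP; split=> [x /= xM|_ [v vM <-]//]; exists x^T; last exact: trmxK.
  by rewrite /A /= trmxK.
apply: continuous_compact; first exact/continuous_subspaceT.
apply: bounded_closed_compact.
  exists (M + enorm c); split=> [|y My v vM]; first exact: num_real.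
  apply: le_trans (ltW My); rewrite -(trmxK v).
  apply: le_trans (ler_norm_trmx _) _; apply: le_trans (norm_le_enorm _) _.
  have := enormD (v^T - c) c.
  by rewrite subrK => /le_trans; apply; rewrite lerD2r.
have -> : A = (fun v : 'rV[R]_d => enorm (v^T - c)) @^-1` [set y | y <= M] by
  [].
apply: preimage_closed; last exact: closed_le.
by move=> v _; apply: (@continuous_comp _ _ _ trmx (fun x => enorm (x - c)));
   [exact: ctr|exact: cen].
Qed.

(* The height is minimized over a compact slice of the epigraph of the energy,
   so that closedness of the epigraph stands in for lower semicontinuity. *)
Lemma minimizer_exists H : exists2 J, edom U J &
  forall K, edom U K -> energy H J <= energy H K.
Proof.
have [x0 Ux0] := U_proper.
pose g := gradient u x0 - H; pose b := enorm g + chi * enorm (x0 - Jp).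
have b0 : 0 <= b by rewrite addr_ge0 ?mulr_ge0 ?enorm_ge0.
(* From the gradient inequality at x0. The lone - b absorbs chi |x0 - Jp|, while chi |K - Jp| >= 0
   is dropped. *)
have lowb K : edom U K -> energy H x0 - b * enorm (K - x0) - b
    + sigma / 2 * enorm (K - x0) ^+ 2 <= energy H K.
  move=> UK.
  have := gradient_ineq U_gtNy sigma_gt0 U_convex Ux0 (U_diff Ux0) UK.
  have := dotp_le (- g) (K - x0).
  have := mulr_ge0 chi_ge0 (enorm_ge0 (K - Jp)).
  have := mulr_ge0 (mulr_ge0 chi_ge0 (enorm_ge0 (x0 - Jp)))
    (enorm_ge0 (K - x0)).
  have := enorm_ge0 g.
  rewrite enormN /b /energy /g.
  move: (gradient u x0) (u x0) (u K) (enorm (K - Jp)) => g0 u0 uK e0.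
  move: (enorm (g0 - H)) (enorm (x0 - Jp)) (enorm (K - x0)) => e1 e2 e3.
  rewrite !dotpE.
  move: (dotp g0 K) (dotp g0 x0) (dotp H K) (dotp H x0) => *; lra.
(* For s > M one has s >= 1 and sigma s > 4 b, so sigma/2 s^2 exceeds 2 b s >= b s + b: the sublevel
   set of x0 lies in the ball of radius M. *)
pose M := 1 + 4 / sigma * b.
have leM K : edom U K -> energy H K <= energy H x0 -> enorm (K - x0) <= M.
  move=> /lowb; have := enorm_ge0 (K - x0); rewrite /M.
  move: (enorm (K - x0)) (energy H K) (energy H x0) => s a c s0 h1 h2.
  rewrite leNgt; apply/negP => Ms.
  have : sigma + 4 * b < sigma * s.
    have -> : sigma + 4 * b = sigma * (1 + 4 / sigma * b).
      by field; rewrite gt_eqF.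
    by rewrite ltr_pM2l.
  have s1 : 1 <= s by apply: le_trans (ltW Ms);
    rewrite lerDl mulr_ge0// divr_ge0// ltW.
  have := ler_wpM2l b0 s1; have s0' : 0 < s by apply: lt_le_trans s1.
  by move=> h3 h4; have := h4; rewrite -(ltr_pM2r s0'); nra.
pose lo := energy H x0 - b * M - b.
have lolo K : edom U K -> energy H K <= energy H x0 -> lo <= energy H K.
  move=> UK Kle; have := lowb _ UK; have := ler_wpM2l b0 (leM _ UK Kle);
    rewrite /lo.
  have := mulr_ge0 (divr_ge0 (ltW sigma_gt0) (ler0n R 2))
    (sqr_ge0 (enorm (K - x0))).
  by move: (energy H K) (energy H x0) (sigma / 2 * _) (b * _) (b * M) => *; lra.
(* A height over the energy becomes a height over U, so the epigraph of the energy is the preimage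
   of [epigraph U] under a continuous map. *)
pose psi (p : 'cV[R]_d * R) := (p.1, p.2 + dotp H p.1 - chi * enorm (p.1 - Jp)).
have cpsi : continuous psi.
  move=> p; have c1 : (fun q : 'cV[R]_d * R => dotp H q.1) @ p --> dotp H p.1.
    by apply: (@continuous_comp _ _ _ fst (dotp H));
      [exact: cvg_fst|exact: continuous_dotp].
  have c2 : (fun q : 'cV[R]_d * R => enorm (q.1 - Jp)) @ p --> enorm (p.1 - Jp).
    by apply: (@continuous_comp _ _ _ fst (fun x : 'cV[R]_d => enorm (x - Jp)));
      [exact: cvg_fst|exact: continuous_enormB].
  have c3 : (fun q : 'cV[R]_d * R => q.2) @ p --> p.2 by exact: cvg_snd.
  have c4 : (fun q : 'cV[R]_d * R => q.2 + dotp H q.1 - chi * enorm (q.1 - Jp))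
      @ p --> p.2 + dotp H p.1 - chi * enorm (p.1 - Jp).
    by apply: cvgB; [exact: cvgD|apply: cvgM => //; exact: cvg_cst].
  have c5 : fst @ p --> p.1 by exact: cvg_fst.
  exact: (cvg_pair c5 c4).
pose A := ([set x | enorm (x - x0) <= M] `*` `[lo, energy H x0]) `&`
  psi @^-1` epigraph U.
have AE K : edom U K -> energy H K <= energy H x0 -> A (K, energy H K).
  move=> UK Kle; split; [split => /=|].
  - exact: leM.
  - by rewrite in_itv/= lolo.
  - rewrite /psi /epigraph /= (edom_fineE U_gtNy UK) lee_fin /energy.
    by move: (u K) (dotp H K) (chi * _) => *; lra.
have A0 : A !=set0 by exists (x0, energy H x0); apply: AE.
have cA : compact A.
  apply: compact_closedI.
    by apply: compact_setX; [exact: compact_enorm_ball|exact: segment_compact].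
  by apply: preimage_closed => // p _; exact: cpsi.
have [[J b'] JA minJ] : exists2 c, c \in A & forall t, t \in A -> c.2 <= t.2.
  by apply: compact_EVT_min => //; apply: continuous_subspaceT => p;
    exact: cvg_snd.
have [_] := set_mem JA; rewrite /psi /epigraph /= => Jb.
have UJ : edom U J by apply: le_lt_trans Jb _; rewrite ltry.
have {}Jb : energy H J <= b'.
  move: Jb; rewrite (edom_fineE U_gtNy UJ) lee_fin /energy.
  by move: (u J) (dotp H J) (chi * _) => *; lra.
have small K : edom U K -> energy H K <= energy H x0 ->
    energy H J <= energy H K.
  by move=> UK Kle; apply: le_trans Jb _;
    exact: (minJ (K, _) (mem_set (AE _ UK Kle))).
exists J => // K UK; have [|/ltW] := leP (energy H K) (energy H x0).
  exact: small.
by apply: le_trans; exact: small.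
Qed.

Lemma polarizationP H : edom U (polarization chi Jp U H) /\
  forall K, edom U K -> energy H (polarization chi Jp U H) <= energy H K.
Proof.
have [J UJ minJ] := minimizer_exists H.
have minJ' K : (objective chi Jp U H J <= objective chi Jp U H K)%E.
  have [UK|UK] := pselect (edom U K); last by rewrite (objective_ndom H UK)
    leey.
  by rewrite !objectiveE// lee_fin minJ.
(* Existence of a minimizer excludes the default value of [xget]. *)
rewrite /polarization; case: xgetP => [K _ minK|/(_ J)]; last by case.
have UK : edom U K.
  apply: contrapT => UK; have := minK J.
  by rewrite (objective_ndom H UK) objectiveE// leye_eq.
by split => // L UL; have := minK L; rewrite !objectiveE// lee_fin.
Qed.

Local Notation pol := (polarization chi Jp U).

(** Sum of the two growth inequalities; the energies for H1 and H2 differ only by a linear term. *)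
Lemma polarization_mono H1 H2 :
  sigma * enorm (pol H1 - pol H2) ^+ 2 <= dotp (H1 - H2) (pol H1 - pol H2).
Proof.
have [U1 m1] := polarizationP H1; have [U2 m2] := polarizationP H2.
have := energy_min_gap U1 U2 m1; have := energy_min_gap U2 U1 m2.
rewrite (enormBC (pol H2)) /energy !dotpE.
move: (u _) (u _) (enorm (pol H1 - pol H2)) (enorm _) (enorm _) => a b c e f.
move: (dotp _ _) (dotp _ _) (dotp _ _) (dotp _ _) => *; lra.
Qed.

Lemma polarization_lipschitz H1 H2 :
  sigma * enorm (pol H1 - pol H2) <= enorm (H1 - H2).
Proof.
have [->|] := eqVneq (pol H1) (pol H2).
  by rewrite subrr enorm0 mulr0 enorm_ge0.
rewrite -subr_eq0 -enorm_gt0 => p0; rewrite -(ler_pM2r p0) -mulrA -expr2.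
exact: le_trans (polarization_mono _ _) (dotp_le _ _).
Qed.

Lemma coenergyE mu0 H :
  coenergy mu0 chi Jp U H = mu0 / 2 * enorm H ^+ 2 - energy H (pol H).
Proof.
have [UJ minJ] := polarizationP H; rewrite /coenergy.
suff -> : ereal_inf (range (objective chi Jp U H)) =
  (energy H (pol H))%:E by [].
apply/eqP; rewrite eq_le; apply/andP; split.
  by apply: ereal_inf_lbound; exists (pol H) => //; rewrite objectiveE.
apply: le_ereal_inf_tmp => _ [K _ <-].
have [UK|UK] := pselect (edom U K); last by rewrite (objective_ndom H UK) leey.
by rewrite objectiveE// lee_fin minJ.
Qed.

(** Envelope argument: comparing each minimizer in the other's energy puts the remainder of the
    minimal energy between 0 and <H' - H, J' - J> <= |H' - H|^2 / sigma. With the term mu0/2 |H' -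
    H|^2 this gives the constant [k]. *)
Lemma inductionE mu0 : induction mu0 chi Jp U = fun H => mu0 *: H + pol H.
Proof.
apply/funext => H; apply: enorm_gradient => e e0.
pose k : R := `|mu0| / 2 + sigma^-1.
have k0 : 0 < k by rewrite ltr_wpDl ?divr_ge0// invr_gt0.
exists (e / k) => [|H']; first by rewrite divr_gt0.
rewrite ltr_pdivlMr// mulrC => /ltW hk.
apply: (@le_trans _ _ (k * enorm (H' - H) * enorm (H' - H))); last first.
  by rewrite ler_wpM2r ?enorm_ge0.
have [U1 m1] := polarizationP H; have [U2 m2] := polarizationP H'.
have lip := polarization_lipschitz H' H.
have si0 : 0 < sigma^-1 by rewrite invr_gt0.
rewrite -(ler_pM2l si0) mulKf ?gt_eqF// in lip.
have cs := dotp_le (H' - H) (pol H' - pol H).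
have := m1 _ U2; have := m2 _ U1; rewrite !coenergyE /energy.
move: (pol H) (pol H') lip cs => J J' lip cs h1 h2.
have hh : dotp (H' - H) (J' - J) <= sigma^-1 * enorm (H' - H) ^+ 2.
  by apply: le_trans cs _; rewrite mulrC expr2 mulrA ler_wpM2r ?enorm_ge0.
have mu_le : `|mu0 / 2 * enorm (H' - H) ^+ 2| <=
  `|mu0| / 2 * enorm (H' - H) ^+ 2.
  by rewrite normrM (ger0_norm (sqr_ge0 _)) normrM (@ger0_norm _ 2^-1)//
    invr_ge0.
move: mu_le; rewrite ler_norml => /andP[mu1 mu2].
rewrite ler_norml /k -mulrA -expr2 mulrDl.
move: (u J) (u J') h1 h2 hh mu1 mu2 => a b.
rewrite !sqr_enorm !dotpE (dotpC H' H) (dotpC J H) (dotpC J H').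
move: (enorm (J - Jp)) (enorm (J' - Jp)) => x1 x2.
move: (dotp H J) (dotp H J') (dotp H' J) (dotp H' J') => x3 x4 x5 x6.
move: (dotp H H) (dotp H H') (dotp H' H') `|mu0| (sigma^-1) => *; lra.
Qed.

End Minimizer.

(** * Expansion of the unit vector map *)

Section UnitVector.
Context {R : realType} {d : nat}.
Implicit Types (a b v w : 'cV[R]_d).

(* [normalize 0 = 0], because [0^-1 = 0]. *)
Definition normalize w : 'cV[R]_d := (enorm w)^-1 *: w.

(** Divided by |w|, this is the derivative of [normalize] at w != 0; at w = 0 it is the identity. *)
Definition orthoproj w : 'M[R]_d := 1%:M - enorm w ^- 2 *: (w *m w^T).

Lemma enorm_normalize w : w != 0 -> enorm (normalize w) = 1.
Proof.
rewrite -enorm_gt0 => w0.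
by rewrite enormZ gtr0_norm ?invr_gt0// mulVf// gt_eqF.
Qed.

Lemma enorm_normalizeK w : enorm w *: normalize w = w.
Proof.
have [->|] := eqVneq w 0; first by rewrite /normalize !scaler0.
by rewrite -enorm_gt0 => w0; rewrite scalerA mulfV ?scale1r// gt_eqF.
Qed.

Lemma dotp_normalize w : dotp (normalize w) w = enorm w.
Proof.
rewrite dotpZl -sqr_enorm expr2 mulrA; have [->|] := eqVneq w 0.
  by rewrite enorm0 mulr0.
by rewrite -enorm_gt0 => w0; rewrite mulVf ?mul1r// gt_eqF.
Qed.

Lemma orthoprojE w v :
  orthoproj w *m v = v - dotp (normalize w) v *: normalize w.
Proof.
rewrite mulmxBl mul1mx -scalemxAl -mulmxA mx11_dotp mul_mx_scalar.
rewrite dotpZl !scalerA; congr (_ - _ *: _); rewrite -exprVn; ring.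
Qed.

Lemma orthoproj_self w : orthoproj w *m w = 0.
Proof.
by rewrite orthoprojE dotp_normalize enorm_normalizeK subrr.
Qed.

(** An orthogonal projection is symmetric and idempotent. *)
Lemma dotp_orthoproj w v x :
  dotp (orthoproj w *m v) x = dotp (orthoproj w *m v) (orthoproj w *m x).
Proof.
have [->|w0] := eqVneq w 0.
  by rewrite !orthoprojE /normalize scaler0 !dotp0l !scale0r !subr0.
have := sqr_enorm (normalize w); rewrite enorm_normalize// expr1n !orthoprojE.
move: (normalize w) => n n1; rewrite !dotpE -n1 (dotpC v n).
by ring.
Qed.

Lemma orthoproj_ge0 w v : 0 <= dotp (orthoproj w *m v) v.
Proof. by rewrite dotp_orthoproj dotp_ge0. Qed.

Lemma enorm_orthoproj_le w v : enorm (orthoproj w *m v) <= enorm v.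
Proof.
have := dotp_orthoproj w v v; rewrite -sqr_enorm;
  have := dotp_le (orthoproj w *m v) v.
have := enorm_ge0 (orthoproj w *m v); rewrite le0r => /orP[/eqP -> *|p0].
  exact: enorm_ge0.
by move=> h1 h2; rewrite h2 expr2 (ler_pM2l p0) in h1.
Qed.

(** The right-hand side equals (|a|^2 + |b|^2) / (2 |a|), so the claim is 2 |a| |b| <= |a|^2 +
    |b|^2. *)
Lemma enorm_le_tangent a b : a != 0 ->
  enorm b <= enorm a + dotp (normalize a) (b - a) +
    enorm (b - a) ^+ 2 / (2 * enorm a).
Proof.
rewrite -enorm_gt0 => a0.
have -> : enorm a + dotp (normalize a) (b - a)
  + enorm (b - a) ^+ 2 / (2 * enorm a) =
    (enorm a ^+ 2 + enorm b ^+ 2) / (2 * enorm a).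
  rewrite dotpZl; have := sqr_enorm a; have := sqr_enorm (b - a).
  have := sqr_enorm b; rewrite !dotpE (dotpC b a).
  move: (dotp a a) (dotp b b) (dotp a b) (enorm (b - a)) (enorm b) => x y z s t.
  move: (enorm a) a0 => r r0 h1 h2 h3.
  by rewrite h2 h1 -h3; field; rewrite gt_eqF.
rewrite ler_pdivlMr ?mulr_gt0//.
have := sqr_ge0 (enorm a - enorm b); move: (enorm a) (enorm b) => x y; nra.
Qed.

Lemma enorm_ge_tangent a b : a != 0 ->
  enorm a + dotp (normalize a) (b - a) <= enorm b.
Proof.
move=> a0; have := dotp_le (normalize a) b.
rewrite enorm_normalize// mul1r dotpDr dotpNr dotp_normalize; apply: le_trans.
by rewrite addrCA subrr addr0.
Qed.

Lemma normalize_lipschitz a b : a != 0 -> b != 0 ->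
  enorm a * enorm (normalize b - normalize a) <= 2 * enorm (b - a).
Proof.
move=> a0 b0; rewrite -{1}[enorm a](gtr0_norm _) ?enorm_gt0// -enormZ.
have -> : enorm a *: (normalize b - normalize a) =
    (b - a) - (enorm b - enorm a) *: normalize b.
  rewrite scalerBr enorm_normalizeK scalerBl (enorm_normalizeK b).
  by apply/colP => i; rewrite !mxE; ring.
apply: le_trans (enormB _ _) _; rewrite enormZ enorm_normalize// mulr1.
by have := normr_enormB b a; move: `|enorm b - enorm a| (enorm (b - a)) => *;
  lra.
Qed.

(** After multiplication by |a| the remainder splits into (|b| - |a|) times the difference of the
    unit vectors, and the second-order remainder of the norm times a unit vector. They contribute 2
    and 1/2, rounded up to 3. *)
Lemma normalize_expansion a b : a != 0 -> b != 0 ->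
  enorm (normalize b - normalize a - (enorm a)^-1 *: (orthoproj a *m (b - a)))
    <= 3 * enorm (b - a) ^+ 2 / enorm a ^+ 2.
Proof.
move=> a0 b0; have ea0 : 0 < enorm a by rewrite enorm_gt0.
have lip := normalize_lipschitz a0 b0.
have l1 := enorm_le_tangent b a0; have l2 := enorm_ge_tangent b a0.
have l3 := normr_enormB b a.
rewrite ler_pdivlMr ?exprn_gt0// [in leLHS]expr2 mulrA.
have enormZa v : enorm v * enorm a = enorm (enorm a *: v).
  by rewrite enormZ gtr0_norm// mulrC.
rewrite enormZa.
have -> : enorm a *: (normalize b - normalize a -
      (enorm a)^-1 *: (orthoproj a *m (b - a))) =
    - ((enorm b - enorm a) *: (normalize b - normalize a) +
       (enorm b - enorm a - dotp (normalize a) (b - a)) *: normalize a).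
  rewrite orthoprojE 2!scalerBr enorm_normalizeK !scalerA mulfV ?gt_eqF//
    scale1r.
  move: (enorm_normalizeK b) (enorm_normalizeK a).
  move: (dotp _ _) => s; move: (normalize a) (normalize b) => n m hb ha.
  apply/colP => i; move: (congr1 (fun v => v i 0) hb)
    (congr1 (fun v => v i 0) ha).
  by rewrite !mxE => <- <-; field; rewrite !enorm_eq0 a0 b0.
have hx := enormD ((enorm b - enorm a) *: (normalize b - normalize a))
  ((enorm b - enorm a - dotp (normalize a) (b - a)) *: normalize a).
rewrite enormN (enormZ (enorm b - enorm a)) in hx *.
rewrite (enormZ _ (normalize a)) (enorm_normalize a0) mulr1 in hx.
have h0 : 0 <= enorm b - enorm a - dotp (normalize a) (b - a).
  by move: (enorm b) (enorm a) (dotp _ _) l2 => *; lra.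
rewrite (ger0_norm h0) in hx.
have {}l1 : (enorm b - enorm a - dotp (normalize a) (b - a)) * enorm a
    <= enorm (b - a) ^+ 2 / 2.
  rewrite -ler_pdivlMr// -mulrA -invfM.
  by move: (enorm b) (enorm a) (dotp _ _) (_ / _) l1 => *; lra.
have l4 : `|enorm b - enorm a| * (enorm a * enorm (normalize b - normalize a))
  <=
   enorm (b - a) * (2 * enorm (b - a)).
  by rewrite ler_pM// mulr_ge0 ?enorm_ge0.
apply: le_trans (ler_wpM2r (ltW ea0) hx) _.
move: l1 l4 (sqr_ge0 (enorm (b - a))) {hx h0 l2 l3 lip}.
move: `|enorm b - enorm a| (enorm (normalize _ - _)) (_ - dotp _ _)
  (enorm (b - a)).
move: (enorm a) => *; lra.
Qed.

End UnitVector.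

(** * Optimality conditions *)

Section FirstOrder.
Context {R : realType} {d : nat} (U : 'cV[R]_d -> \bar R) (sigma chi : R).
Context (Jp : 'cV[R]_d).
Hypothesis U_gtNy : forall J, U J <> -oo%E.
Hypothesis sigma_gt0 : 0 < sigma.
Hypothesis U_convex : strongly_convex sigma U.
Hypothesis chi_ge0 : 0 <= chi.
Hypothesis U_open : open (edom U).
Hypothesis U_diff : forall x, edom U x -> differentiable (fine \o U) x.

Local Notation u := (fine \o U : 'cV[R]_d -> R).
Local Notation E := (energy U chi Jp).

(** First variation along v, with c in place of the one-sided derivative of the norm. This covers
    both J != Jp, where c is linear in v, and the kink J = Jp, where c = |v|. *)
Lemma energy_min_variation H J v (c C : R) : edom U J ->
  (forall K, edom U K -> E H J <= E H K) -> 0 <= C ->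
  (forall t : R, 0 < t ->
     enorm (J - Jp + t *: v) <= enorm (J - Jp) + t * c + t ^+ 2 * C) ->
  0 <= dotp (gradient u J - H) v + chi * c.
Proof.
move=> UJ minJ C0 hC.
have /near_enorm[s s0 hs] : \forall y \near J, edom U y by exact:
  (open_nbhs_nbhs (conj U_open UJ)).
apply: (@ler_addsmall _ _ _ (enorm v + chi * C)) => e e0 e1.
have [r r0 hr] := differentiable_gradient (U_diff UJ) e0.
pose N := enorm v + 1; have N0 : 0 < N by rewrite ltr_wpDl// enorm_ge0.
pose q := Num.min r s; have q0 : 0 < q by rewrite lt_min r0.
(* t <= e makes the term t^2 C negligible; the other bound keeps J + t v in the domain and in the
   range of the expansion. *)
pose t := Num.min e (q / (2 * N)).
have t0 : 0 < t by rewrite lt_min e0 divr_gt0// mulr_gt0.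
have te : t <= e by rewrite ge_min lexx.
have tv : enorm (t *: v) < q.
  rewrite enormZ gtr0_norm//; apply: (@lt_trans _ _ (t * N)).
    by rewrite ltr_pM2l// ltrDl.
  apply: (@le_lt_trans _ _ (q / (2 * N) * N)).
    by rewrite ler_wpM2r ?(ltW N0)// ge_min lexx orbT.
  by rewrite invfM mulrA divfK ?gt_eqF// ltr_pdivrMr//; lra.
have zx : J + t *: v - J = t *: v by rewrite addrC addKr.
have {hs} Uz : edom U (J + t *: v).
  by apply: hs; rewrite zx; apply: lt_le_trans tv _; rewrite ge_min lexx orbT.
have {hr} : `|u (J + t *: v) - u J - dotp (gradient u J) (t *: v)| <=
  e * enorm (t *: v).
  by have := hr (J + t *: v); rewrite zx; apply; apply: lt_le_trans tv _;
    rewrite ge_min lexx.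
have := minJ _ Uz; have := hC _ t0; rewrite /energy (addrAC J) => {}hC.
have := ler_wpM2l chi_ge0 hC.
move: (enorm (J - Jp + t *: v)) (enorm (J - Jp)) => z1 z2.
have tC : t * (t * (chi * C)) <= t * (e * (chi * C)).
  by rewrite ler_wpM2l ?(ltW t0)// ler_wpM2r// mulr_ge0.
rewrite ler_norml enormZ (gtr0_norm t0) !dotpE => h1 h2 /andP[_ h3].
move: (u _) (u _) (dotp _ _) (dotp _ _) (dotp _ _) (enorm v) h1 h2 h3.
move=> a b w1 w2 w3 w4 h1 h2 h3.
by rewrite -(ler_pM2l t0) mulr0; lra.
Qed.

(** The variation along minus the residual g gives - |g|^2 >= 0. *)
Lemma energy_min_stationary H J : edom U J ->
  (forall K, edom U K -> E H J <= E H K) -> J != Jp \/ chi = 0 ->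
  gradient u J + chi *: normalize (J - Jp) = H.
Proof.
move=> UJ minJ hJ.
pose g := gradient u J + chi *: normalize (J - Jp) - H.
suff : 0 <= - dotp g g.
  rewrite oppr_ge0 -sqr_enorm => g0; apply/eqP; rewrite -subr_eq0 -enorm_eq0.
  by rewrite -sqrf_eq0 eq_le g0 sqr_ge0.
have [w0|w0] := eqVneq (J - Jp) 0.
  have chi0 : chi = 0 by case: hJ => //; rewrite -subr_eq0 w0 eqxx.
  have := @energy_min_variation H J (- g) (enorm g) 0 UJ minJ (lexx _) _.
  have <- : g = gradient u J - H by rewrite /g chi0 scale0r addr0.
  rewrite w0 enorm0 chi0 mul0r addr0 dotpNr; apply.
  by move=> t t0; rewrite !add0r enormZ enormN gtr0_norm// mulr0 addr0.
have := @energy_min_variation H J (- g) (dotp (normalize (J - Jp)) (- g))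
  (enorm (- g) ^+ 2 / (2 * enorm (J - Jp))) UJ minJ _ _.
have -> : dotp (gradient u J - H) (- g)
  + chi * dotp (normalize (J - Jp)) (- g) =
    - dotp g g.
  by rewrite -dotpZl -dotpDl addrAC -/g dotpNr.
apply; first by rewrite divr_ge0 ?sqr_ge0// mulr_ge0 ?enorm_ge0.
move=> t t0; apply: le_trans (enorm_le_tangent _ w0) _.
rewrite (addrC _ (t *: _)) addrK enormZ gtr0_norm// dotpZr exprMn mulrA.
by rewrite lexx.
Qed.

(** At the kink the variation along - g gives |g|^2 <= chi |g|. *)
Lemma energy_min_ball H : edom U Jp ->
  (forall K, edom U K -> E H Jp <= E H K) -> enorm (H - gradient u Jp) <= chi.
Proof.
move=> UJ minJ; pose g := gradient u Jp - H.
have : 0 <= dotp g (- g) + chi * enorm g.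
  apply: (@energy_min_variation H Jp (- g) (enorm g) 0) => // t t0.
  by rewrite subrr !add0r enorm0 enormZ enormN gtr0_norm// mulr0 addr0 add0r.
rewrite dotpNr -sqr_enorm enormBC -/g.
have := enorm_ge0 g; rewrite le0r => /orP[/eqP -> //|g0].
by move=> h; rewrite -(ler_pM2r g0) -expr2; move: (chi * _) (_ ^+ 2) h => *;
  lra.
Qed.

(** The gradient inequality at Jp leaves <H - grad U(Jp), K - Jp>, which chi |K - Jp| dominates. *)
Lemma energy_ball_min H : edom U Jp -> enorm (H - gradient u Jp) <= chi ->
  forall K, edom U K -> E H Jp <= E H K.
Proof.
move=> UJ hH K UK.
have := gradient_ineq U_gtNy sigma_gt0 U_convex UJ (U_diff UJ) UK.
have := dotp_le (H - gradient u Jp) (K - Jp).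
have := ler_wpM2r (enorm_ge0 (K - Jp)) hH.
have := mulr_ge0 (divr_ge0 (ltW sigma_gt0) (ler0n R 2))
  (sqr_ge0 (enorm (K - Jp))).
rewrite /energy subrr enorm0 mulr0 addr0.
move: (gradient u Jp) (u K) (u Jp) => g a b; rewrite !dotpE.
move: (enorm (H - g)) (enorm (K - Jp)) (dotp H K) (dotp H Jp) (dotp g K)
  (dotp g Jp).
by move=> *; lra.
Qed.

End FirstOrder.

(** * Regularity of the polarization *)

(* D, G, K and J stand for the domain, the gradient and the Hessian of U and for
   the polarization; only the properties below are used of them. *)
Section Inclusion.
Context {R : realType} {d : nat}.
Context (sigma chi : R) (Jp : 'cV[R]_d) (D : set 'cV[R]_d).
Context (G : 'cV[R]_d -> 'cV[R]_d) (K : 'cV[R]_d -> 'M[R]_d).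
Context (J : 'cV[R]_d -> 'cV[R]_d).
Hypothesis sigma_gt0 : 0 < sigma.
Hypothesis chi_ge0 : 0 <= chi.
Hypothesis J_dom : forall H, D (J H).
Hypothesis J_lip : forall H1 H2,
  sigma * enorm (J H1 - J H2) <= enorm (H1 - H2).
Hypothesis G_diff : forall x, D x -> forall e : R, 0 < e ->
  exists2 r : R, 0 < r & forall y, enorm (y - x) < r ->
    enorm (G y - G x - K x *m (y - x)) <= e * enorm (y - x).
Hypothesis K_cont : forall x, D x -> forall e : R, 0 < e ->
  exists2 r : R, 0 < r & forall y, enorm (y - x) < r -> `|K y - K x| <= e.
Hypothesis K_coercive : forall x v, D x ->
  sigma * enorm v ^+ 2 <= dotp (K x *m v) v.
Hypothesis J_stationary : forall H, J H != Jp \/ chi = 0 ->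
  G (J H) + chi *: normalize (J H - Jp) = H.
Hypothesis J_ball : forall H, J H = Jp -> enorm (H - G Jp) <= chi.
Hypothesis ball_J : forall H, D Jp -> enorm (H - G Jp) <= chi -> J H = Jp.

Local Notation w H := (J H - Jp).
Local Notation smooth H := (J H != Jp \/ chi = 0).

(** The matrix A(H) inverted in [induction_slope]. When J(H) = Jp, division by 0 gives 0 and leaves
    the Hessian alone, which is the right matrix for chi = 0. *)
Definition tangent (H : 'cV[R]_d) : 'M[R]_d :=
  K (J H) + (chi / enorm (w H)) *: orthoproj (w H).

Lemma tangentE H (v : 'cV[R]_d) :
  tangent H *m v = K (J H) *m v + (chi / enorm (w H)) *: (orthoproj (w H) *m v).
Proof. by rewrite mulmxDl -scalemxAl. Qed.

Lemma tangent_coercive H (v : 'cV[R]_d) : sigma * enorm v ^+ 2 <=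
  dotp (tangent H *m v) v.
Proof.
rewrite tangentE dotpDl dotpZl; apply: le_trans (K_coercive v (J_dom H)) _.
by rewrite lerDl mulr_ge0 ?orthoproj_ge0// divr_ge0 ?enorm_ge0.
Qed.

Lemma J_lipV H1 H2 : enorm (J H1 - J H2) <= sigma^-1 * enorm (H1 - H2).
Proof. by rewrite ler_pdivlMl. Qed.

(** * Points where J differs from Jp or chi vanishes *)

Lemma G_semismooth x : D x -> forall e : R, 0 < e ->
  exists2 r : R, 0 < r & forall y, enorm (y - x) < r ->
    enorm (G y - G x - K y *m (y - x)) <= e * enorm (y - x).
Proof.
move=> Dx; pose c : R := 1 + d%:R * d%:R.
apply: (@eps_rescale _ c) => [a b ab [r r0 hr]|e e0 _].
  exists r => // y /hr /le_trans; apply; by rewrite ler_wpM2r ?enorm_ge0.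
have [r1 r10 h1] := G_diff Dx e0; have [r2 r20 h2] := K_cont Dx e0.
exists (Num.min r1 r2) => [|y]; first by rewrite lt_min r10.
rewrite lt_min => /andP[/h1 {}h1 /h2 {}h2].
(* Continuity of [K] allows the Hessian at x to be replaced by the one at y. *)
have -> : G y - G x - K y *m (y - x) =
    (G y - G x - K x *m (y - x)) - (K y - K x) *m (y - x).
  by rewrite mulmxBl opprB addrA subrK.
apply: le_trans (enormB _ _) _; rewrite /c mulrDl mul1r mulrDl lerD//.
apply: le_trans (enorm_mulmx_le _ _) _.
by rewrite ler_wpM2r ?enorm_ge0// ler_wpM2l// mulr_ge0.
Qed.

(* The expansion is centred at P: with P = H0 it gives differentiability at H0,
   with Q = H0 the semismoothness estimate. *)
Lemma pair_bound P Q : smooth P -> smooth Q ->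
  sigma * enorm (J Q - J P - invmx (tangent P) *m (Q - P)) <=
    enorm (G (J Q) - G (J P) - K (J P) *m (J Q - J P))
      + chi * (3 * enorm (J Q - J P) ^+ 2 / enorm (w P) ^+ 2).
Proof.
move=> sP sQ; have unitA := coercive_unitmx sigma_gt0 (@tangent_coercive P).
apply: le_trans (coercive_enorm_le (@tangent_coercive P) _) _.
rewrite mulmxBr mulmxA mulmxV// mul1mx tangentE.
have -> : Q - P = G (J Q) - G (J P)
    + chi *: (normalize (w Q) - normalize (w P)).
  rewrite -{1}(J_stationary sQ) -{1}(J_stationary sP).
  by rewrite scalerBr; apply/colP => i; rewrite !mxE; ring.
have -> : K (J P) *m (J Q - J P) + (chi / enorm (w P)) *:
  (orthoproj (w P) *m (J Q - J P))
    - (G (J Q) - G (J P) + chi *: (normalize (w Q) - normalize (w P))) =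
   - (G (J Q) - G (J P) - K (J P) *m (J Q - J P)) - chi *:
     (normalize (w Q) - normalize (w P) -
      (enorm (w P))^-1 *: (orthoproj (w P) *m (w Q - w P))).
  have -> : w Q - w P = J Q - J P by apply/colP => i; rewrite !mxE; ring.
  move: (K (J P) *m _) (orthoproj _ *m _) (enorm _)^-1 => a1 a2 a3.
  move: (normalize _) (normalize _) (G (J Q)) (G (J P)) => n1 n2 g1 g2.
  by apply/colP => i; rewrite !mxE; ring.
apply: le_trans (enormB _ _) _; rewrite enormN lerD2l enormZ ger0_norm//.
(* For chi = 0 the vectors J - Jp may vanish, but the normalized terms carry the factor chi. *)
have [->|chi0] := eqVneq chi 0; first by rewrite !mul0r.
rewrite ler_wpM2l//; have -> : J Q - J P = w Q - w P.
  by apply/colP => i; rewrite !mxE; ring.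
apply: normalize_expansion.
- by case: sP => [|/eqP]; [rewrite subr_eq0|rewrite (negbTE chi0)].
- by case: sQ => [|/eqP]; [rewrite subr_eq0|rewrite (negbTE chi0)].
Qed.

(** By the Lipschitz bound |J(H) - Jp| stays above half its value at H0, which makes the curvature
    constant uniform near H0. *)
Lemma smooth_near H0 : smooth H0 -> exists2 r : R, 0 < r &
  exists2 c : R, 0 <= c & forall H, enorm (H - H0) < r -> smooth H /\
    forall x, 0 <= x -> chi * (3 * x / enorm (w H) ^+ 2) <= c * x.
Proof.
have [chi0 _|chi0 [|/eqP]] := eqVneq chi 0; last by rewrite (negbTE chi0).
  exists 1 => //; exists 0 => // H _; split; first by right.
  by move=> x _; rewrite chi0 !mul0r.
rewrite -subr_eq0 -enorm_gt0 => w0; pose m := enorm (w H0) / 2.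
have m0 : 0 < m by rewrite divr_gt0.
exists (sigma * m); first by rewrite mulr_gt0.
exists (chi * 3 / m ^+ 2) => [|H hH].
  by rewrite !mulr_ge0// invr_ge0 sqr_ge0.
have mw : m <= enorm (w H).
  have : sigma * enorm (J H - J H0) < sigma * m by apply: le_lt_trans hH.
  rewrite ltr_pM2l//; have := enormD (w H) (J H0 - J H).
  have -> : w H + (J H0 - J H) = w H0 by apply/colP => i; rewrite !mxE; ring.
  rewrite (enormBC (J H0) (J H)) /m; move: (enorm _) (enorm _) (enorm _) => *;
    lra.
split; first by left; rewrite -subr_eq0 -enorm_gt0 (lt_le_trans m0).
move=> x x0; rewrite !mulrA mulrAC ler_wpM2r// ler_wpM2l ?mulr_ge0//.
by rewrite lef_pV2 ?posrE ?exprn_gt0// ?(lt_le_trans m0)// lerXn2r ?nnegrE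
  ?(ltW m0)// enorm_ge0.
Qed.

Lemma smooth_pair H0 : smooth H0 -> forall e : R, 0 < e ->
  exists2 r : R, 0 < r & forall H, enorm (H - H0) < r -> smooth H /\
   (enorm (J H - J H0 - invmx (tangent H0) *m (H - H0)) <= e * enorm (H - H0) /\
    enorm (J H - J H0 - invmx (tangent H) *m (H - H0)) <= e * enorm (H - H0)).
Proof.
move=> s0; have [r1 r10 [c c0 hc]] := smooth_near s0.
(* One factor 1/sigma inverts the tangent matrix; the others bound J(H) - J(H0), once in the linear
   term and twice in the quadratic one. *)
pose k := (sigma^-1 ^+ 2 + sigma^-1 ^+ 3 * c).
have si0 : 0 < sigma^-1 by rewrite invr_gt0.
apply: (@eps_rescale _ k) => [a b ab [r rp hr]|e e0 _].
  exists r => // y /hr [? [ha hb]]; split=> //; split.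
    by apply: le_trans ha _; rewrite ler_wpM2r ?enorm_ge0.
  by apply: le_trans hb _; rewrite ler_wpM2r ?enorm_ge0.
have [r2 r20 h2] := G_semismooth (J_dom H0) e0.
have [r3 r30 h3] := G_diff (J_dom H0) e0.
(* A radius below e turns |H - H0|^2 into e |H - H0|; the factor sigma sends J(H) into the
   neighbourhoods for [G]. *)
pose r := Num.min (Num.min r1 e) (sigma * Num.min r2 r3).
exists r => [|H]; first by rewrite !lt_min r10 e0 mulr_gt0// lt_min r20.
rewrite !lt_min => /andP[/andP[Hr1 He] Hr23].
have dlt : enorm (J H - J H0) < Num.min r2 r3.
  by rewrite -(ltr_pM2l sigma_gt0) (le_lt_trans (J_lip _ _)).
move: dlt; rewrite lt_min => /andP[/h2 {}h2 /h3 {}h3].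
have [sH cH] := hc _ Hr1.
have [_ cH0] : smooth H0 /\ forall x, 0 <= x ->
  chi * (3 * x / enorm (w H0) ^+ 2) <= c * x.
  by apply: hc; rewrite subrr enorm0.
split=> //.
have lip := J_lipV H H0.
have fin X : sigma * X <= e * enorm (J H - J H0)
  + c * enorm (J H - J H0) ^+ 2 ->
    X <= k * e * enorm (H - H0).
  rewrite -ler_pdivlMl// => /le_trans; apply.
  have h0 := enorm_ge0 (H - H0); have d0 := enorm_ge0 (J H - J H0).
  have b1 : e * enorm (J H - J H0) <= e * (sigma^-1 * enorm (H - H0)).
    by rewrite ler_wpM2l ?(ltW e0).
  have b2 : enorm (J H - J H0) ^+ 2 <= sigma^-1 ^+ 2 * (e * enorm (H - H0)).
    apply: (@le_trans _ _ ((sigma^-1 * enorm (H - H0)) ^+ 2)).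
      by rewrite lerXn2r ?nnegrE// mulr_ge0// ltW.
    by rewrite exprMn ler_wpM2l ?sqr_ge0// expr2 ler_wpM2r// ltW.
  have b3 := ler_wpM2l c0 b2.
  rewrite (_ : k * e * _ = sigma^-1 *
    (e * (sigma^-1 * enorm (H - H0)) + c *
    (sigma^-1 ^+ 2 * (e * enorm (H - H0))))).
    by rewrite ler_wpM2l ?(ltW si0)// lerD.
  by rewrite /k; ring.
split; apply: fin.
  apply: le_trans (pair_bound s0 sH) _; rewrite lerD//.
  by apply: cH0; rewrite sqr_ge0.
have := pair_bound sH s0.
have -> : J H0 - J H - invmx (tangent H) *m (H0 - H) =
    - (J H - J H0 - invmx (tangent H) *m (H - H0)).
  by rewrite -(opprB H0 H) mulmxN; apply/colP => i; rewrite !mxE; ring.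
have -> : G (J H0) - G (J H) - K (J H) *m (J H0 - J H) =
    - (G (J H) - G (J H0) - K (J H) *m (J H - J H0)).
  by rewrite -(opprB (J H0) (J H)) mulmxN; apply/colP => i; rewrite !mxE; ring.
rewrite !enormN (enormBC (J H0) (J H)) => /le_trans; apply; rewrite lerD//.
by apply: cH; rewrite sqr_ge0.
Qed.

Lemma smooth_differentiable H : smooth H ->
  differentiable J H /\ jacobian_mx J H = invmx (tangent H).
Proof.
move=> sH; apply: enorm_differentiable => e e0.
have [r r0 hr] := smooth_pair sH e0; exists r; first exact: r0.
by move=> y yr; have [_ [hy _]] := hr y yr; exact: hy.
Qed.

(** * The ball where J = Jp, and its sphere *)

Lemma ball_differentiable H : D Jp -> enorm (H - G Jp) < chi ->
  differentiable J H /\ jacobian_mx J H = 0.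
Proof.
move=> DJp hH; apply: enorm_differentiable => e e0.
exists (chi - enorm (H - G Jp)) => [|y hy]; first by rewrite subr_gt0.
have yJ : J y = Jp.
  apply: ball_J => //; apply: le_trans (enorm_triangle H _ _) _.
  by move: (enorm (y - H)) (enorm (H - G Jp)) hy => *; lra.
rewrite yJ (ball_J DJp (ltW hH)) subrr mul0mx subr0 enorm0.
by rewrite mulr_ge0 ?enorm_ge0// ltW.
Qed.

(** The normal part of a difference of unit vectors is of second order. *)
Lemma dotp_unit_diff (n m : 'cV[R]_d) : enorm n = 1 -> enorm m = 1 ->
  dotp (n - m) n = enorm (n - m) ^+ 2 / 2.
Proof.
move=> n1 m1; rewrite sqr_enorm !dotpE -!sqr_enorm n1 m1 (dotpC n m).
by field.
Qed.

(* The set where J = Jp is convex, so J is constant on the segment [H0, y]. *)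
Lemma ball_constant_direction H0 y : J H0 = Jp -> J y = Jp ->
  differentiable J y -> jacobian_mx J y *m (y - H0) = 0.
Proof.
move=> J0 Jy dJ; have DJp : D Jp by rewrite -J0; exact: J_dom.
set L := jacobian_mx J y; set v := y - H0.
apply: eq_enorm_small; apply: (@eps_rescale _ (enorm v)).
  by move=> a b ab /le_trans; apply.
move=> e e0 _; have [r r0 hr] := differentiable_enorm dJ e0.
(* t <= 1 keeps y - t v on the segment from y to H0, inside the ball. *)
pose t := Num.min 1 (r / (2 * (enorm v + 1))).
have v1 : 0 < enorm v + 1 by rewrite ltr_wpDl// enorm_ge0.
have t0 : 0 < t by rewrite lt_min ltr01 divr_gt0// mulr_gt0.
have t1 : t <= 1 by rewrite ge_min lexx.
have tr : t * enorm v < r.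
  apply: (@lt_trans _ _ (t * (enorm v + 1))); first by rewrite ltr_pM2l// ltrDl.
  apply: (@le_lt_trans _ _ (r / (2 * (enorm v + 1)) * (enorm v + 1))).
    by rewrite ler_wpM2r ?(ltW v1)// ge_min lexx orbT.
  by rewrite invfM mulrA divfK ?gt_eqF// ltr_pdivrMr//; lra.
have zy : y - t *: v - y = - (t *: v) by rewrite addrC addKr.
have := hr (y - t *: v); rewrite zy enormN enormZ gtr0_norm// => /(_ tr).
have -> : J (y - t *: v) = Jp.
  apply: ball_J => //.
  have -> : y - t *: v - G Jp = (1 - t) *: (y - G Jp) + t *: (H0 - G Jp).
    by rewrite /v; apply/colP => i; rewrite !mxE; ring.
  apply: le_trans (enormD _ _) _; rewrite !enormZ !ger0_norm ?subr_ge0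
    ?(ltW t0)//.
  have := ler_wpM2l (ltW t0) (J_ball J0).
  have : (1 - t) * enorm (y - G Jp) <= (1 - t) * chi.
    by rewrite ler_wpM2l ?subr_ge0// J_ball.
  by move: (_ * _) (t * enorm _) => *; lra.
rewrite Jy subrr sub0r enormN mulmxN enormN -/L -scalemxAr enormZ gtr0_norm//.
by rewrite mulrCA (ler_pM2l t0) mulrC.
Qed.

(** A(y) x is paired with x. With z = n - n0 and P the projection, A(y) x = - eps - chi P z - chi
    |z|^2/2 n, and [m] bounds chi |z|. The left side supplies sigma |x|^2 and the curvature term
    chi/|J(y) - Jp| |P x|^2. *)
Lemma J_sphere_estimate H0 y (e1 m : R) (x : 'cV[R]_d) : 0 < chi ->
  J H0 = Jp -> enorm (H0 - G Jp) = chi -> J y != Jp ->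
  enorm (G (J y) - G Jp - K (J y) *m (w y)) <= e1 * enorm (w y) ->
  x = J y - Jp - invmx (tangent y) *m (y - H0) ->
  m = enorm (y - H0) + enorm (G (J y) - G Jp) ->
  sigma * enorm x ^+ 2 <= (e1 * enorm (w y) + m ^+ 2 / (2 * chi)) * enorm x
    + m ^+ 2 / (4 * chi) * enorm (w y).
Proof.
move=> chi0 J0 H0S yJ heps xE mE.
have wy0 : w y != 0 by rewrite subr_eq0.
have ew0 : 0 < enorm (w y) by rewrite enorm_gt0.
pose n := normalize (w y); pose n0 : 'cV[R]_d := chi^-1 *: (H0 - G Jp).
have n1 : enorm n = 1 by exact: enorm_normalize.
have n01 : enorm n0 = 1.
  by rewrite enormZ gtr0_norm ?invr_gt0// H0S mulVf// gt_eqF.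
have n0E : chi *: n0 = H0 - G Jp by rewrite scalerA mulfV ?scale1r// gt_eqF.
have yE : G (J y) + chi *: n = y by apply: J_stationary; left.
set eps := G (J y) - G Jp - K (J y) *m (w y) in heps.
pose z := n - n0; pose P := orthoproj (w y).
have yH0 : y - H0 = G (J y) - G Jp + chi *: z.
  rewrite scalerBr n0E -[X in X - H0]yE.
  by move: (chi *: n) (G _) (G _) => *; apply/colP => i; rewrite !mxE; ring.
have zle : chi * enorm z <= m.
  rewrite -{1}[chi](gtr0_norm chi0) -enormZ mE.
  have -> : chi *: z = (y - H0) - (G (J y) - G Jp) by rewrite yH0 addrAC subrr
    add0r.
  exact: enormB.
have Ax : tangent y *m x =
    - eps - chi *: (P *m z) - (chi * (enorm z ^+ 2 / 2)) *: n.
  have unitA := coercive_unitmx sigma_gt0 (@tangent_coercive y).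
  rewrite xE mulmxBr mulmxA mulmxV// mul1mx tangentE orthoproj_self scaler0
    addr0.
  have -> : P *m z = z - (enorm z ^+ 2 / 2) *: n.
    by rewrite orthoprojE -/n dotpC dotp_unit_diff.
  rewrite yH0.
  have aux (k g a b : 'cV[R]_d) (s : R) :
      k - (g + chi *: a) = - (g - k) - chi *: (a - s *: b) - (chi * s) *: b.
    by apply/colP => i; rewrite !mxE; ring.
  exact: aux.
have := K_coercive x (J_dom y).
have := congr1 (fun v => dotp v x) Ax.
rewrite /= tangentE !dotpDl !dotpNl (dotpZl (chi / _)) (dotpZl chi)
  (dotpZl (chi * _) n).
rewrite -/P (dotp_orthoproj (w y) x) (dotp_orthoproj (w y) z) -/P
  -(sqr_enorm (P *m x)).
move=> E C.
have h1 := dotp_le (- eps) x; rewrite dotpNl enormN in h1.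
have h2 := dotp_le (- (P *m z)) (P *m x); rewrite dotpNl enormN in h2.
have h3 := dotp_le (- n) x; rewrite dotpNl enormN n1 mul1r in h3.
have h4 : enorm (P *m z) <= enorm z := enorm_orthoproj_le _ _.
have m0 : 0 <= m by rewrite mE addr_ge0 ?enorm_ge0.
have z0 := enorm_ge0 z; have x0 := enorm_ge0 x; have p0 := enorm_ge0 (P *m x).
have k1 : chi * (- dotp (P *m z) (P *m x)) <= m * enorm (P *m x).
  apply: le_trans (ler_wpM2l (ltW chi0) h2) _; rewrite mulrA ler_wpM2r//.
  by apply: le_trans zle; rewrite ler_wpM2l// ltW.
(* AM-GM: the curvature term of [tangent y] absorbs the tangential part of z. *)
have k2 : m * enorm (P *m x) <= chi / enorm (w y) * enorm (P *m x) ^+ 2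
    + m ^+ 2 / (4 * chi) * enorm (w y).
  rewrite -subr_ge0.
  have -> : chi / enorm (w y) * enorm (P *m x) ^+ 2
      + m ^+ 2 / (4 * chi) * enorm (w y) - m * enorm (P *m x) =
      (2 * chi * enorm (P *m x) - m * enorm (w y)) ^+ 2 /
        (4 * chi * enorm (w y)).
    by move: (enorm (P *m x)) => p; field; rewrite !gt_eqF.
  by rewrite divr_ge0 ?sqr_ge0// mulr_ge0 ?mulr_ge0 ?enorm_ge0// ltW.
have k3 : chi * (enorm z ^+ 2 / 2) * (- dotp n x) <=
  m ^+ 2 / (2 * chi) * enorm x.
  have c0 : 0 <= chi * (enorm z ^+ 2 / 2).
    by rewrite mulr_ge0 ?divr_ge0 ?sqr_ge0// ltW.
  apply: le_trans (ler_wpM2l c0 h3) _; rewrite ler_wpM2r//.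
  rewrite ler_pdivlMr ?mulr_gt0//.
  have -> : chi * (enorm z ^+ 2 / 2) * (2 * chi) =
    (chi * enorm z) ^+ 2 by field.
  by rewrite lerXn2r ?nnegrE ?mulr_ge0// ltW.
have k4 := le_trans h1 (ler_wpM2r x0 heps).
move: E C k1 k2 k3 k4 {h1 h2 h3 h4 Ax}.
move: (dotp (K _ *m x) x) (dotp eps x) (dotp (P *m z) _) (dotp n x) =>
  q1 q2 q3 q4.
move: (chi / _ * _) (m * enorm _) (sigma * _) (_ / (4 * chi) * _) =>
  q5 q6 q7 q8.
move: (e1 * _) (_ / (2 * chi)) (enorm x) (enorm z) => q9 q10 q11 q12.
by move=> *; lra.
Qed.

Lemma G_locally_lipschitz x : D x -> exists2 r : R, 0 < r &
  exists2 C : R, 0 <= C & forall y, enorm (y - x) < r ->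
    enorm (G y - G x) <= C * enorm (y - x).
Proof.
move=> Dx; have [r r0 hr] := G_diff Dx ltr01; exists r => //.
exists (d%:R * d%:R * `|K x| + 1) => [|y /hr h];
  first by rewrite addr_ge0 ?mulr_ge0.
have -> : G y - G x = K x *m (y - x) + (G y - G x - K x *m (y - x)).
  by rewrite [RHS]subrKC.
apply: le_trans (enormD _ _) _; rewrite mulrDl lerD//.
exact: enorm_mulmx_le.
Qed.

(** With c = 2 b / sigma the hypothesis reads 2 X^2 <= c q X + c q^2. If X > (1 + c) q, then X^2 is
    at least c q X + q X and c q^2 + q^2, the first strictly, and the sum is a contradiction. *)
Lemma quadratic_bound (b q X : R) : 0 <= b -> 0 <= q -> 0 <= X ->
  sigma * X ^+ 2 <= b * q * X + b * q ^+ 2 -> X <= (1 + 2 * b / sigma) * q.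
Proof.
move=> b0 q0 X0 h; rewrite leNgt; apply/negP; set c := 2 * b / sigma => lt.
have bE : b = sigma * c / 2 by rewrite /c; field; rewrite gt_eqF.
have c0 : 0 <= c by rewrite mulr_ge0 ?mulr_ge0// invr_ge0 ltW.
have cq : 0 <= c * q by rewrite mulr_ge0.
have Xp : 0 < X by lra.
have {}h : 2 * X ^+ 2 <= c * q * X + c * q ^+ 2.
  by rewrite -(ler_pM2l sigma_gt0); move: h; rewrite bE; lra.
have h1 : c * q * X + q * X < X * X by rewrite -mulrDl ltr_pM2r//; lra.
have h2 : c * q * q + q * q <= X * X by rewrite -mulrDl ler_pM//; lra.
by have := mulr_ge0 q0 X0; have := mulr_ge0 q0 q0; lra.
Qed.

(** On the sphere, writing h = |y - H0| and X for the left-hand norm, [J_sphere_estimate] becomes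
    sigma X^2 <= b (e h) X + b (e h)^2, so X = O(e h). If H0 is interior, no y near H0 has J(y) !=
    Jp. *)
Lemma sphere_semismooth H0 : 0 < chi -> J H0 = Jp -> forall e : R, 0 < e ->
  exists2 r : R, 0 < r & forall y, enorm (y - H0) < r -> J y != Jp ->
    enorm (J y - Jp - invmx (tangent y) *m (y - H0)) <= e * enorm (y - H0).
Proof.
move=> chi0 J0; have DJp : D Jp by rewrite -J0; exact: J_dom.
have := J_ball J0; rewrite le_eqVlt => /orP[/eqP H0S|lt]; last first.
  move=> e _; exists (chi - enorm (H0 - G Jp)) => [|y hy];
    first by rewrite subr_gt0.
  suff -> : J y = Jp by rewrite eqxx.
  apply: ball_J => //; apply: le_trans (enorm_triangle H0 _ _) _.
  by move: (enorm (y - H0)) (enorm (H0 - G Jp)) hy => *; lra.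
have [r1 r10 [C C0 hC]] := G_locally_lipschitz DJp.
pose c1 := 1 + C * sigma^-1.
have si0 : 0 < sigma^-1 by rewrite invr_gt0.
have c10 : 0 <= c1 by rewrite addr_ge0// mulr_ge0// ltW.
pose b := sigma^-1 + c1 ^+ 2 / (2 * chi) + c1 ^+ 2 / (4 * chi) * sigma^-1.
have b1 : 0 <= c1 ^+ 2 / (2 * chi) by rewrite divr_ge0 ?sqr_ge0// mulr_ge0//
  ltW.
have b2 : 0 <= c1 ^+ 2 / (4 * chi) by rewrite divr_ge0 ?sqr_ge0// mulr_ge0//
  ltW.
have b3 : 0 <= c1 ^+ 2 / (4 * chi) * sigma^-1 by rewrite mulr_ge0// ltW.
have b0 : 0 <= b by rewrite !addr_ge0// ltW.
apply: (@eps_rescale _ (1 + 2 * b / sigma)) => [a a' aa [r r0 hr]|e e0 e1].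
  exists r => // y hy yJ; apply: le_trans (hr y hy yJ) _.
  by rewrite ler_wpM2r ?enorm_ge0.
have e20 : 0 < e ^+ 2 by rewrite exprn_gt0.
have [r2 r20 h2] := G_semismooth DJp e20.
(* The term m^2 |J(y) - Jp| is of order h^3; h <= e^2 is what turns it into (e h)^2. *)
exists (Num.min (e ^+ 2) (sigma * Num.min r1 r2)) => [|y].
  by rewrite lt_min e20 mulr_gt0// lt_min r10.
rewrite lt_min => /andP[ye yr] yJ.
have wlt : enorm (J y - Jp) < Num.min r1 r2.
  by rewrite -(ltr_pM2l sigma_gt0) -{1}J0 (le_lt_trans (J_lip _ _)).
move: wlt; rewrite lt_min => /andP[/hC {}hC /h2 {}h2].
have est := J_sphere_estimate chi0 J0 H0S yJ h2 (erefl _) (erefl _).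
have W := J_lipV y H0; rewrite J0 in W.
move: est hC W ye (enorm_ge0 (y - H0)) (enorm_ge0 (J y - Jp)).
move: (enorm_ge0 (J y - Jp - invmx (tangent y) *m (y - H0)))
  (enorm_ge0 (G (J y) - G Jp)).
move: (enorm (J y - Jp - _)) (enorm (y - H0)) (enorm (J y - Jp))
  (enorm (G _ - _)).
move=> X h w' g X0 g0 est hC W ye h0 w0.
rewrite -[leRHS]mulrA; apply: quadratic_bound => //;
  first by rewrite mulr_ge0// ltW.
apply: (le_trans est).
have mle : (h + g) ^+ 2 <= c1 ^+ 2 * h ^+ 2.
  rewrite -exprMn lerXn2r ?nnegrE ?addr_ge0 ?mulr_ge0//.
  rewrite /c1 mulrDl mul1r lerD2l; apply: le_trans hC _.
  by rewrite -mulrA ler_wpM2l.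
have he : h ^+ 2 <= e ^+ 2 * h by rewrite expr2 ler_wpM2r// ltW.
have ee : e ^+ 2 * h <= e * h by rewrite ler_wpM2r// expr2 ler_piMr// ltW.
have t1 : e ^+ 2 * w' <= sigma^-1 * (e * h).
  apply: le_trans (ler_wpM2l (ltW e20) W) _.
  by rewrite mulrCA ler_wpM2l// ltW.
have t2 : (h + g) ^+ 2 / (2 * chi) <= c1 ^+ 2 / (2 * chi) * (e * h).
  apply: (@le_trans _ _ (c1 ^+ 2 / (2 * chi) * h ^+ 2)).
    by rewrite [leRHS]mulrAC ler_wpM2r// invr_ge0 mulr_ge0// ltW.
  by rewrite ler_wpM2l// (le_trans he).
have t3 : (h + g) ^+ 2 / (4 * chi) * w' <=
  c1 ^+ 2 / (4 * chi) * sigma^-1 * (e * h) ^+ 2.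
  apply: (@le_trans _ _ (c1 ^+ 2 / (4 * chi) * h ^+ 2 * (sigma^-1 * h))).
    by rewrite ler_pM ?divr_ge0 ?sqr_ge0 ?mulr_ge0 ?(ltW chi0)//
      [leRHS]mulrAC ler_wpM2r// invr_ge0 mulr_ge0// ltW.
  have -> : c1 ^+ 2 / (4 * chi) * h ^+ 2 * (sigma^-1 * h) =
     c1 ^+ 2 / (4 * chi) * sigma^-1 * (h ^+ 2 * h) by ring.
  rewrite ler_wpM2l//; apply: le_trans (ler_wpM2r h0 he) _.
  by rewrite -mulrA -expr2 exprMn.
have eh0 : 0 <= e * h by rewrite mulr_ge0// ltW.
have t12 := ler_wpM2r X0 (lerD t1 t2).
have b4 := mulr_ge0 (mulr_ge0 b3 eh0) X0.
have b5 : 0 <= sigma^-1 * (e * h) ^+ 2 by rewrite mulr_ge0 ?sqr_ge0// ltW.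
have b6 : 0 <= c1 ^+ 2 / (2 * chi) * (e * h) ^+ 2 by rewrite mulr_ge0 ?sqr_ge0.
rewrite /b.
move: (c1 ^+ 2 / (4 * chi) * _) ((h + g) ^+ 2 / (4 * chi) * _)
  ((h + g) ^+ 2 / (2 * chi)) (c1 ^+ 2 / (2 * chi)) (e ^+ 2 * w') t12 t3 b4 b5
  b6.
move: (sigma^-1) (e * h) => *; lra.
Qed.

(* The limit is max(0, <v, n0>) / <K(Jp) n0, n0> n0, for n0 the outer normal. *)
Lemma sphere_directional H0 v : 0 < chi -> J H0 = Jp ->
  enorm (H0 - G Jp) = chi -> exists l, has_directional J H0 v l.
Proof.
move=> chi0 J0 H0S; have DJp : D Jp by rewrite -J0; exact: J_dom.
pose n0 : 'cV[R]_d := chi^-1 *: (H0 - G Jp).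
have n01 : enorm n0 = 1.
  by rewrite enormZ gtr0_norm ?invr_gt0// H0S mulVf// gt_eqF.
have n0E : chi *: n0 = H0 - G Jp by rewrite scalerA mulfV ?scale1r// gt_eqF.
move: n0 n01 n0E => n0 n01 n0E.
pose k := dotp (K Jp *m n0) n0; pose a := dotp v n0; pose s := Num.max 0 a / k.
have sk : sigma <= k.
  by have := K_coercive n0 DJp; rewrite n01 expr1n mulr1.
have k0 : 0 < k by apply: lt_le_trans sk.
exists (s *: n0); pose C : R := d%:R * d%:R * `|K Jp|; pose V := enorm v.
have C0 : 0 <= C by rewrite !mulr_ge0.
have V0 : 0 <= V by exact: enorm_ge0.
have si0 : 0 < sigma^-1 by rewrite invr_gt0.
(* [c3] and [c2] bound |J(y) - Jp| / t and |n - n0| / t; [B] below bounds the error in the normal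
   component. *)
pose c3 := V * sigma^-1; pose c2 := (V + (C + 1) * c3) / chi.
have c30 : 0 <= c3 by rewrite mulr_ge0// ltW.
have c20 : 0 <= c2.
  exact: divr_ge0 (addr_ge0 V0 (mulr_ge0 (addr_ge0 C0 ler01) c30)) (ltW chi0).
pose B := c3 * C * c2 + c3 + chi * (c2 ^+ 2 / 2).
have B0 : 0 <= B.
  apply: addr_ge0 (addr_ge0 (mulr_ge0 (mulr_ge0 c30 C0) c20) c30) _.
  by rewrite mulr_ge0 ?(ltW chi0)// divr_ge0// sqr_ge0.
apply: (@eps_rescale _ (c3 * c2 + B * sigma^-1)) => [b b' bb [r r0 hr]|e e0 e1].
  by exists r => // t t0 tr; apply: le_trans (hr t t0 tr) bb.
have [r1 r10 h1] := G_diff DJp e0.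
have V1 : 0 < V + 1 by rewrite ltr_wpDl.
exists (Num.min e (sigma * r1 / (V + 1))) => [|t t0].
  by rewrite lt_min e0 divr_gt0// mulr_gt0.
rewrite lt_min ltr_pdivlMr// => /andP[te tr]; rewrite J0.
set y := H0 + t *: v.
have yH0 : y - H0 = t *: v by rewrite /y addrC addKr.
have Wle : enorm (w y) <= t * c3.
  by have := J_lipV y H0; rewrite J0 yH0 enormZ gtr0_norm// mulrC /c3 mulrA.
have rhs0 : 0 <= (c3 * c2 + B * sigma^-1) * e.
  exact: mulr_ge0 (addr_ge0 (mulr_ge0 c30 c20) (mulr_ge0 B0 (ltW si0)))
    (ltW e0).
have [Jy|yJ] := eqVneq (J y) Jp.
  rewrite Jy subrr scaler0 sub0r enormN enormZ n01 mulr1.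
  (* If y = H0 + t v is still in the ball, then |chi n0 + t v| <= chi, so v does not point
     outwards. *)
  suff a0 : a <= 0 by rewrite /s (max_idPl a0) mul0r normr0.
  have : enorm (chi *: n0 + t *: v) ^+ 2 <= chi ^+ 2.
    rewrite lerXn2r ?nnegrE ?enorm_ge0// n0E addrAC -/y.
    exact: J_ball Jy.
  rewrite sqr_enorm !dotpE (dotpC n0 v) -/a -!sqr_enorm n01 expr1n -/V.
  have := sqr_ge0 (t * V) => sq0 sq1.
  by rewrite -(pmulr_rle0 _ (mulr_gt0 chi0 t0)); lra.
have wy0 : w y != 0 by rewrite subr_eq0.
have W0 := enorm_ge0 (w y).
pose n := normalize (w y); pose z := n - n0.
have n1 : enorm n = 1 by exact: enorm_normalize.
have yE : G (J y) + chi *: n = y by apply: J_stationary; left.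
have wn : w y = enorm (w y) *: n by rewrite enorm_normalizeK.
set eps := G (J y) - G Jp - K Jp *m w y.
have tvE : t *: v = K Jp *m w y + eps + chi *: z.
  rewrite -yH0 -[X in X - H0]yE scalerBr n0E /eps.
  have aux (g1 g2 q p r : 'cV[R]_d) : g1 + q - p =
    r + (g1 - g2 - r) + (q - (p - g2)).
    by apply/colP => i; rewrite !mxE; ring.
  exact: aux.
have epsle : enorm eps <= e * enorm (w y).
  apply: h1; rewrite -(ltr_pM2l sigma_gt0) -J0.
  apply: le_lt_trans (J_lip _ _) _; rewrite yH0 enormZ gtr0_norm// -/V.
  by apply: le_lt_trans tr; rewrite ler_wpM2l ?(ltW t0)// lerDl.
have Kle x : enorm (K Jp *m x) <= C * enorm x by exact: enorm_mulmx_le.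
have zle : enorm z <= t * c2.
  rewrite /c2 mulrA ler_pdivlMr// mulrC -[X in X * _](gtr0_norm chi0) -enormZ.
  have -> : chi *: z = t *: v - (K Jp *m w y + eps) by rewrite tvE addrAC subrr
    add0r.
  apply: le_trans (enormB _ _) _; rewrite enormZ gtr0_norm// -/V mulrDr lerD2l.
  apply: le_trans (enormD _ _) _.
  apply: (@le_trans _ _ ((C + 1) * enorm (w y))); last first.
    by rewrite mulrCA ler_wpM2l ?addr_ge0.
  by rewrite mulrDl mul1r lerD// (le_trans epsle)// ler_piMl.
have z0 := enorm_ge0 z.
(* The expansion of t v is paired with n0, where z contributes only at second order. *)
have inner : t * a - enorm (w y) * k =
    enorm (w y) * dotp (K Jp *m z) n0 + dotp eps n0 - chi * (enorm z ^+ 2 / 2).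
  rewrite /a -(dotpZl t v) tvE !dotpDl (dotpZl chi) {1}wn -scalemxAr
    (dotpZl (enorm _)).
  have -> : n = n0 + z by rewrite /z subrKC.
  rewrite mulmxDr dotpDl -/k.
  have -> : dotp z n0 = - (enorm z ^+ 2 / 2).
    rewrite /z -(opprB n0 n) dotpNl dotp_unit_diff//.
    by rewrite enormN.
  by ring.
have q1 : `|dotp (K Jp *m z) n0| <= C * (t * c2).
  apply: le_trans (cauchy_schwarz _ _) _; rewrite n01 mulr1.
  exact: le_trans (Kle z) (ler_wpM2l C0 zle).
have q2 : `|dotp eps n0| <= e * (t * c3).
  apply: le_trans (cauchy_schwarz _ _) _; rewrite n01 mulr1.
  exact: le_trans epsle (ler_wpM2l (ltW e0) Wle).
have q3 : enorm z ^+ 2 <= (t * c2) ^+ 2.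
  by rewrite lerXn2r ?nnegrE// mulr_ge0// ltW.
pose rho := enorm (w y) / t.
have rho0 : 0 <= rho by rewrite divr_ge0// ltW.
have rho3 : rho <= c3 by rewrite ler_pdivrMr// mulrC.
have arho : `|a - rho * k| <= e * B.
  rewrite -(ler_pM2l t0) -{1}(gtr0_norm t0) -normrM.
  have -> : t * (a - rho * k) = t * a - enorm (w y) * k.
    by rewrite /rho; field; rewrite gt_eqF.
  rewrite inner; apply: le_trans (ler_normB _ _) _.
  have p1 := ler_normD (enorm (w y) * dotp (K Jp *m z) n0) (dotp eps n0).
  have p2 : `|enorm (w y) * dotp (K Jp *m z) n0| <= (t * c3) * (C * (t * c2)).
    by rewrite normrM ger0_norm// ler_pM.
  have p3 : `|chi * (enorm z ^+ 2 / 2)| <= chi * ((t * c2) ^+ 2 / 2).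
    rewrite ger0_norm ?mulr_ge0 ?divr_ge0 ?sqr_ge0 ?(ltW chi0)//.
    by rewrite ler_wpM2l ?(ltW chi0)// ler_wpM2r// invr_ge0.
  have tte : t * t <= t * e by rewrite ler_wpM2l// ltW.
  have p4 := ler_wpM2r (mulr_ge0 (mulr_ge0 c30 C0) c20) tte.
  have p5 := ler_wpM2r (mulr_ge0 (ltW chi0)
    (divr_ge0 (sqr_ge0 c2) (ler0n R 2))) tte.
  move: p1 p2 p3 q2 p4 p5; rewrite /B.
  move: (enorm (w y) * dotp (K Jp *m z) n0) (dotp eps n0)
    (chi * (enorm z ^+ 2 / 2)).
  by move=> A1 A2 A3; move: `|A1 + A2| `|A1| `|A2| `|A3| => *; lra.
have srho : `|rho - s| <= e * B * sigma^-1.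
  rewrite ler_pdivlMr//; apply: (@le_trans _ _ (`|rho - s| * k)).
    by rewrite ler_wpM2l.
  rewrite -{1}(gtr0_norm k0) -normrM mulrBl /s divfK ?gt_eqF//.
  have rk : 0 <= rho * k by rewrite mulr_ge0// ltW.
  move: arho; rewrite maxEle; case: ifPn => [a0|]; first by rewrite distrC.
  (* For a < 0 the bound on a - rho k gives rho k <= e B, although a itself need not be small. *)
  rewrite -ltNge => a0; rewrite subr0 (ger0_norm rk) ler_norml => /andP[h _].
  by move: (e * B) h => *; lra.
have -> : t^-1 *: (J y - Jp) - s *: n0 = rho *: z + (rho - s) *: n0.
  rewrite [in LHS]wn scalerA mulrC -/rho /z.
  have aux (p q : R) (x x' : 'cV[R]_d) : p *: x - q *: x' =
    p *: (x - x') + (p - q) *: x'.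
    by apply/colP => i; rewrite !mxE; ring.
  exact: aux.
apply: le_trans (enormD _ _) _; rewrite !enormZ n01 mulr1 (ger0_norm rho0).
have f1 : rho * enorm z <= c3 * (e * c2).
  by rewrite ler_pM// (le_trans zle)// ler_wpM2r// ltW.
by move: srho f1; move: `|rho - s| (rho * _) => *; lra.
Qed.

(** * Assembly over all points, and the interior limit of Jacobians *)

Lemma J_directional H v : exists l, has_directional J H v l.
Proof.
have [chi0|chi0] := eqVneq chi 0.
  have [dJ _] := smooth_differentiable (or_intror chi0 : smooth H).
  by exists (jacobian_mx J H *m v); exact: differentiable_has_directional.
have chip : 0 < chi by rewrite lt0r chi0.
have [JH|JH] := eqVneq (J H) Jp; last first.
  have [dJ _] := smooth_differentiable (or_introl JH : smooth H).
  by exists (jacobian_mx J H *m v); exact: differentiable_has_directional.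
have := J_ball JH; rewrite le_eqVlt => /orP[/eqP HS|lt].
  exact: sphere_directional.
have DJp : D Jp by rewrite -JH; exact: J_dom.
have [dJ _] := ball_differentiable DJp lt.
by exists (jacobian_mx J H *m v); exact: differentiable_has_directional.
Qed.

(** If J(H0) = Jp and chi > 0, a nearby point y of differentiability either has J(y) = Jp, where the
    Jacobian kills y - H0, or falls under the sphere estimate. *)
Lemma J_semismooth_estimate H0 : forall e : R, 0 < e ->
  exists2 r : R, 0 < r & forall y, enorm (y - H0) < r -> differentiable J y ->
    enorm (J y - J H0 - jacobian_mx J y *m (y - H0)) <= e * enorm (y - H0).
Proof.
move=> e e0; have [s0|] := pselect (smooth H0).
  have [r r0 hr] := smooth_pair s0 e0; exists r => // y /hr [sy [_ h]] _.
  by have [_ ->] := smooth_differentiable sy; exact: h.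
move=> /not_orP[/negP]; rewrite negbK => /eqP J0 /eqP chi0.
have chip : 0 < chi by rewrite lt0r chi0.
have [r r0 hr] := sphere_semismooth chip J0 e0; exists r => // y yr dJ.
have [Jy|Jy] := eqVneq (J y) Jp.
  rewrite (ball_constant_direction J0 Jy dJ) Jy J0 subrr subr0 enorm0.
  by rewrite mulr_ge0 ?enorm_ge0// ltW.
have [_ ->] := smooth_differentiable (or_introl Jy : smooth y).
by rewrite J0; exact: hr.
Qed.

Lemma semismooth_scale_add (mu : R) : semismooth (fun H => mu *: H + J H).
Proof.
move=> H0; apply: (@semismooth_atP _ _ _ _ _ (`|mu| + sigma^-1)).
- move=> y z; have -> : mu *: y + J y - (mu *: z + J z) =
    mu *: (y - z) + (J y - J z).
    by apply/colP => i; rewrite !mxE; ring.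
  apply: le_trans (enormD _ _) _; rewrite enormZ mulrDl lerD2l.
  exact: J_lipV.
- apply: has_directionalP => v; have [l hl] := J_directional H0 v.
  exists (mu *: v + l) => e /hl [r r0 hr]; exists r => // t t0 /(hr t t0).
  congr (enorm _ <= _); move: (J _) (J H0) => j j0.
  by apply/colP => i; rewrite !mxE; field; rewrite gt_eqF.
- move=> e /(J_semismooth_estimate H0) [r r0 hr]; exists r => // y yr dF.
  have JE : J = fun x => (- mu) *: x + (mu *: x + J x).
    by apply/funext => x; rewrite scaleNr addKr.
  have [dJ _] := scale_add_differentiable (- mu) dF; rewrite -JE in dJ.
  have [_ ->] := scale_add_differentiable mu dJ.
  move: (hr y yr dJ); congr (enorm _ <= _); rewrite mulmxDl mul_scalar_mx.
  move: (_ *m _) (J y) (J H0) => *; apply/colP => i; rewrite !mxE; ring.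
Qed.

(* Radial approach: the points u_k are interior to the ball even if H is on the
   sphere. *)
Lemma ball_bouligand (mu : R) H : 0 < chi -> J H = Jp ->
  bouligand (fun H => mu *: H + J H) H mu%:M.
Proof.
move=> chi0 JH; have DJp : D Jp by rewrite -JH; exact: J_dom.
(* [harmonic k] is 1/(k + 1), so u_0 is the centre of the ball and u_k tends to H. *)
pose u (k : nat) := H - harmonic k *: (H - G Jp).
have hin k : enorm (u k - G Jp) < chi.
  have h0 : 0 < harmonic k :> R by exact: harmonic_gt0.
  have h1 : harmonic k <= 1 :> R by rewrite /harmonic/= invf_le1 ?ler1n.
  have -> : u k - G Jp = (1 - harmonic k) *: (H - G Jp).
    by rewrite /u; apply/colP => i; rewrite !mxE; ring.
  rewrite enormZ ger0_norm ?subr_ge0//.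
  apply: (@le_lt_trans _ _ ((1 - harmonic k) * chi)).
    by rewrite ler_wpM2l ?subr_ge0// J_ball.
  by rewrite gtr_pMl// ltrBlDr ltrDl.
have du k : differentiable (fun H => mu *: H + J H) (u k) /\
    jacobian_mx (fun H => mu *: H + J H) (u k) = mu%:M.
  have [dJ jJ] := ball_differentiable DJp (hin k).
  by have [dB ->] := scale_add_differentiable mu dJ; rewrite jJ addr0.
exists u; split=> [k||]; first by case: (du k).
  have /cvgrPdist_lt hc := @cvg_harmonic R.
  have n1 : 0 < enorm (H - G Jp) + 1 by rewrite ltr_wpDl// enorm_ge0.
  apply/cvgrPdist_lt => e e0.
  have := hc (e / (enorm (H - G Jp) + 1)); rewrite divr_gt0// => /(_ isT).
  apply: filterS => k; rewrite sub0r normrN ltr_pdivlMr// => hk.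
  apply: le_lt_trans hk; apply: le_trans (norm_le_enorm _) _.
  by rewrite /u opprB addrC subrK enormZ ler_wpM2l// lerDl.
rewrite (_ : (fun k => _) = fun=> mu%:M); first exact: cvg_cst.
by apply/funext => k; case: (du k).
Qed.

End Inclusion.

(** * The material law *)

Unset Implicit Arguments.

(** The premise of the second claim excludes chi = 0 with J(H) = Jp. There B is continuously
    differentiable near H with Jacobian mu0 I plus the inverse Hessian at J(H), so the generalized
    Jacobian is that single matrix and does not contain the value mu0 I of the first branch. *)
Theorem theorem12 (R : realType) (d : nat) (hd : d = 2%N \/ d = 3%N)
    (mu0 : R) (hmu0 : 0 < mu0)
    (Jp : 'cV[R]_d) (chi : R) (hchi : 0 <= chi)
    (U : 'cV[R]_d -> \bar R) (hUNy : forall J, U J <> -oo%E)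
    (hproper : edom U !=set0) (hclosed : closed_fun U)
    (sigma : R) (hsigma : 0 < sigma) (hconvex : strongly_convex sigma U)
    (hC2 : C2_on_domain U) :
  semismooth (induction mu0 chi Jp U) /\
  forall H : 'cV[R]_d,
    (chi = 0 -> polarization chi Jp U H <> Jp) ->
    clarke (induction mu0 chi Jp U) H (induction_slope mu0 chi Jp U H).
Proof.
have [U_open U_C2] := hC2.
have U_diff x : edom U x -> differentiable (fine \o U) x by case/U_C2.
pose J := polarization chi Jp U; pose D := edom U.
pose G := gradient (fine \o U : 'cV[R]_d -> R).
pose K := hessian (fine \o U : 'cV[R]_d -> R).
have J_min H : edom U (J H) /\
    forall L, edom U L -> energy U chi Jp H (J H) <= energy U chi Jp H L.
  exact: polarizationP hUNy hproper hclosed hsigma hconvex hchi U_diff H.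
have J_dom H : D (J H) by case: (J_min H).
have J_lip H1 H2 : sigma * enorm (J H1 - J H2) <= enorm (H1 - H2).
  exact: polarization_lipschitz.
have G_diff x : D x -> forall e : R, 0 < e -> exists2 r : R, 0 < r & forall y,
    enorm (y - x) < r -> enorm (G y - G x - K x *m (y - x)) <=
      e * enorm (y - x).
  by case/U_C2 => _ dG _; exact: differentiable_enorm.
have K_cont x : D x -> forall e : R, 0 < e -> exists2 r : R, 0 < r & forall y,
    enorm (y - x) < r -> `|K y - K x| <= e.
  case/U_C2 => _ _ /cvgrPdist_le cK e /cK /near_enorm [r r0 hr].
  exists r; [exact: r0|move=> y yr].
  by rewrite -normrN opprB; exact: hr y yr.
have K_coercive x v : D x -> sigma * enorm v ^+ 2 <= dotp (K x *m v) v.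
  by move=> Dx; apply: hessian_ge => //; case: (U_C2 _ Dx).
have J_stationary H : J H != Jp \/ chi = 0 ->
    G (J H) + chi *: normalize (J H - Jp) = H.
  by have [UJ minJ] := J_min H; exact: energy_min_stationary.
have J_ball H : J H = Jp -> enorm (H - G Jp) <= chi.
  move=> JH; have [UJ minJ] := J_min H.
  by rewrite -/J JH in UJ minJ; exact: energy_min_ball UJ minJ.
have ball_J H : D Jp -> enorm (H - G Jp) <= chi -> J H = Jp.
  move=> DJp hH; have [UJ minJ] := J_min H.
  have minJp := energy_ball_min hUNy hsigma hconvex U_diff DJp hH.
  exact: (minimizer_unique hUNy hsigma hconvex hchi DJp UJ minJp minJ).
have -> : induction mu0 chi Jp U = fun H => mu0 *: H + J H.
  exact: (inductionE Jp hUNy hproper hclosed hsigma hconvex hchi U_diff).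
split; first exact: (semismooth_scale_add hsigma hchi J_dom J_lip G_diff K_cont
  K_coercive J_stationary J_ball ball_J).
move=> H chiH; rewrite /induction_slope -/J.
(* If J(H) = Jp, the slope is a limit of Jacobians from inside the ball; otherwise it is the
   Jacobian of B at H itself. *)
have [JH|JH] := eqVneq (J H) Jp.
  have chi0 : 0 < chi.
    by rewrite lt0r hchi andbT; apply/eqP => /chiH; rewrite -/J JH.
  apply: sub_gen_smallest.
  exact: (ball_bouligand J_dom J_ball ball_J mu0 chi0 JH).
have [dJ jJ] := smooth_differentiable hsigma hchi J_dom J_lip G_diff K_cont
  K_coercive J_stationary (or_introl JH).
have [dB jB] := scale_add_differentiable mu0 dJ.
by have := differentiable_clarke dB; rewrite jB jJ.
Qed.
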